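(* Let $p$ be a prime, $u\in\mathbb C\setminus\{0\}$, $n\in\mathbb N$. There exists a unique $p$-adic linear Markov trace defined as $$\tau:=\varprojlim\tau_r:\ \mathrm Y_{\infty,n+1}(u)\longrightarrow\varprojlim\mathbb C[\mathrm X_r],$$ that is, a unique map whose $r$-th component is $\tau_r$ applied to the $r$-th component for every $r$. Furthermore $$\tau(ab)=\tau(ba),\qquad \tau(1)=1,\qquad \tau(ag_nb)=(z)_r\,\tau(ab),\qquad \tau(a\,\mathbf t_{n+1}^m\,b)=(x_m)_r\,\tau(ab)$$ for any $a,b\in\mathrm Y_{\infty,n}(u)$ and $m\in\mathbb Z$.
   Context: Inverse systems are indexed by $\mathbb N=\{1,2,\ldots\}$. Yokonuma–Hecke algebras. For $d\ge1$ let $H=\langle h\rangle$ be cyclic of order $d$ and $h_i\in H^n$ the element with $h$ in position $i$ and $1$ elsewhere. The braid group $B_n$ (standard generators $\sigma_1,\ldots,\sigma_{n-1}$) acts on $H^n$ by permuting coordinates via $B_n\to S_n$, $\sigma_i\mapsto(i,i+1)$; $\mathcal F_{d,n}=H^n\rtimes B_n$ with $(a,\sigma)(b,\tau)=(a\,\sigma(b),\sigma\tau)$. With $e_{d,i}=\frac1d\sum_{m=1}^dh_i^mh_{i+1}^{-m}$, the algebra $\mathrm Y_{d,n}(u)$ is the quotient of $\mathbb C\mathcal F_{d,n}$ by the two-sided ideal generated by $\sigma_i^2-1-(u-1)e_{d,i}(1-\sigma_i)$, $1\le i\le n-1$; $g_i$ denotes the image of $\sigma_i$, and $h_i$ also denotes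 its image. The natural inclusions $\mathcal F_{d,n}\subset\mathcal F_{d,n+1}$ induce a tower $\mathbb C=\mathrm Y_{d,0}(u)\subset\mathrm Y_{d,1}(u)\subset\mathrm Y_{d,2}(u)\subset\cdots$. Known trace (Juyumaya). For indeterminates $z,x_1,\ldots,x_{d-1}$ there is a unique linear trace $\mathrm{tr}$ on $\bigcup_n\mathrm Y_{d,n}(u)$ with values in $\mathbb C[z,x_1,\ldots,x_{d-1}]$ such that $\mathrm{tr}(ab)=\mathrm{tr}(ba)$, $\mathrm{tr}(1)=1$, and, for every $n$ and all $a,b\in\mathrm Y_{d,n}(u)$, $\mathrm{tr}(ag_nb)=z\,\mathrm{tr}(ab)$ and $\mathrm{tr}(ah_{n+1}^mb)=x_m\,\mathrm{tr}(ab)$ for $m=1,\ldots,d-1$. For $d=p^r$ this trace is denoted $\tau_r$, with values in $\mathbb C[\mathrm X_r]$, $\mathrm X_r=\{z,x_1,\ldots,x_{p^r-1}\}$. Inverse limits. For $r\ge s$, $\varphi^r_s:\mathrm Y_{p^r,n}(u)\to\mathrm Y_{p^s,n}(u)$ is the algebra epimorphism with $h_i\mapsto h_i$, $g_i\mapsto g_i$, and $\mathrm Y_{\infty,n}(u):=\varprojlim\mathrm Y_{p^r,n}(u)$; the inclusions $\mathrm Y_{p^r,n}(u)\subset\mathrm Y_{p^r,n+1}(u)$ induce $\mathrm Y_{\infty,n}(u)\subset\mathrm Y_{\infty,n+1}(u)$. In $\mathrm Y_{\infty,n+1}(u)$, $g_n$ denotes the constant sequence $(g_n,g_n,\ldots)$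 and $\mathbf t_{n+1}$ the element whose $r$-th component is $h_{n+1}\in\mathrm Y_{p^r,n+1}(u)$. For $r\ge s$, $\delta^r_s:\mathbb C[\mathrm X_r]\to\mathbb C[\mathrm X_s]$ is the ring ($\mathbb C$-algebra) epimorphism with $\delta^r_s(z)=z$, $\delta^r_s(x_i)=1$ if $i\equiv0\pmod{p^s}$, and $\delta^r_s(x_i)=x_j$ if $i\equiv j\pmod{p^s}$ with $1\le j\le p^s-1$. The limit $\varprojlim\mathbb C[\mathrm X_r]$ is taken with respect to these maps. For $m\in\mathbb Z$, $(x_m)_r$ is the sequence whose $r$-th entry is $x_j\in\mathbb C[\mathrm X_r]$, where $0\le j<p^r$, $j\equiv m\pmod{p^r}$, with the convention $x_0:=1$; $(z)_r$ is the constant sequence $(z,z,\ldots)$. *)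

(* Defs.v *)
From HB Require Import structures.
From mathcomp Require Import mpoly monalg.
From mathcomp Require Import all_boot all_order all_fingroup all_algebra.
From mathcomp Require Import generic_quotient finmap.
From mathcomp Require Import boolp reals complex.

Set Implicit Arguments.
Unset Strict Implicit.
Unset Printing Implicit Defensive.

Import GRing.Theory Num.Theory.

Local Open Scope quotient_scope.

Section PresentedGroup.
Local Open Scope group_scope.

(* The letter (x, true) stands for x and (x, false) for its inverse. *)
Variables (X : choiceType)
  (rel : seq (X * bool) -> seq (X * bool) -> Prop).
Local Notation word := (seq (X * bool)).
Implicit Types w u v : word.

Inductive word_congr : word -> word -> Prop :=
| wc_refl w : word_congr w w
| wc_sym w w' : word_congr w w' -> word_congr w' w
| wc_trans w1 w2 w3 : word_congr w1 w2 -> word_congr w2 w3 -> word_congr w1 w3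
| wc_ctx u v w w' : word_congr w w' -> word_congr (u ++ w ++ v) (u ++ w' ++ v)
| wc_cancel x b : word_congr [:: (x, b); (x, ~~ b)] [::]
| wc_rel w w' : rel w w' -> word_congr w w'.

Definition word_congrb w w' : bool := `[< word_congr w w' >].

Fact word_congrb_refl : reflexive word_congrb.
Proof. by move=> w; apply/asboolP; exact: wc_refl. Qed.

Fact word_congrb_sym : symmetric word_congrb.
Proof. by move=> w w'; apply/asboolP/asboolP; exact: wc_sym. Qed.

Fact word_congrb_trans : transitive word_congrb.
Proof.
by move=> w2 w1 w3 /asboolP h /asboolP h'; apply/asboolP; exact: wc_trans h h'.
Qed.

Canonical word_congr_equiv :=
  EquivRel word_congrb word_congrb_refl word_congrb_sym word_congrb_trans.

Definition presented := {eq_quot word_congr_equiv}.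
HB.instance Definition _ := Choice.on presented.
HB.instance Definition _ := EqQuotient.on presented.

Lemma presented_eqP w w' :
  reflect (word_congr w w') (\pi_presented w == \pi_presented w').
Proof. by rewrite eqmodE; exact: asboolP. Qed.

Lemma presented_eq w w' :
  word_congr w w' -> \pi_presented w = \pi_presented w'.
Proof. by move=> h; apply/eqP/presented_eqP. Qed.

Lemma presented_repr w : word_congr (repr (\pi_presented w)) w.
Proof. by apply/presented_eqP; rewrite reprK. Qed.

Definition word_inv w : word := rev [seq (l.1, ~~ l.2) | l <- w].

Lemma word_inv_cons l w : word_inv (l :: w) = word_inv w ++ [:: (l.1, ~~ l.2)].
Proof. by rewrite /word_inv /= rev_cons cats1. Qed.

Lemma word_invK : involutive word_inv.
Proof.
move=> w; rewrite /word_inv map_rev revK -map_comp.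
by rewrite map_id_in // => -[x b] _ /=; rewrite negbK.
Qed.

Lemma wc_cat w1 w1' w2 w2' : word_congr w1 w1' -> word_congr w2 w2' ->
  word_congr (w1 ++ w2) (w1' ++ w2').
Proof.
move=> h1 h2; apply: (@wc_trans _ (w1' ++ w2)); first exact: (wc_ctx [::] w2 h1).
by have := wc_ctx w1' [::] h2; rewrite !cats0.
Qed.

Lemma wc_inv_l w : word_congr (w ++ word_inv w) [::].
Proof.
elim: w => [|[x b] w IH]; first exact: wc_refl.
rewrite word_inv_cons /= catA.
apply: wc_trans (wc_cancel x b).
exact: (wc_ctx [:: (x, b)] [:: (x, ~~ b)] IH).
Qed.

Lemma wc_inv_r w : word_congr (word_inv w ++ w) [::].
Proof. by have := wc_inv_l (word_inv w); rewrite word_invK. Qed.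

Lemma wc_inv w w' : word_congr w w' -> word_congr (word_inv w) (word_inv w').
Proof.
move=> h.
apply: (@wc_trans _ (word_inv w ++ (w' ++ word_inv w'))).
  rewrite -[X in word_congr X]cats0.
  by apply: wc_cat; [exact: wc_refl | apply/wc_sym/wc_inv_l].
rewrite catA -[X in word_congr _ X]cat0s; apply: wc_cat; last exact: wc_refl.
apply: wc_trans (wc_inv_r w).
by apply: wc_cat; [exact: wc_refl | exact: wc_sym].
Qed.

Definition presented_mul (x y : presented) : presented :=
  \pi_presented (repr x ++ repr y).
Definition presented_inv (x : presented) : presented :=
  \pi_presented (word_inv (repr x)).
Definition presented_one : presented := \pi_presented [::].

Lemma presented_mulE w w' :
  presented_mul (\pi_presented w) (\pi_presented w') = \pi_presented (w ++ w').
Proof. by apply/presented_eq/wc_cat; exact: presented_repr. Qed.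

Lemma presented_invE w :
  presented_inv (\pi_presented w) = \pi_presented (word_inv w).
Proof. by apply/presented_eq/wc_inv; exact: presented_repr. Qed.

Fact presented_mulA : associative presented_mul.
Proof.
move=> x y z; rewrite -[x]reprK -[y]reprK -[z]reprK.
by rewrite (presented_mulE (repr y)) (presented_mulE (repr x) (repr y)) !presented_mulE catA.
Qed.

Fact presented_mul1 : left_id presented_one presented_mul.
Proof. by move=> x; rewrite -[x]reprK presented_mulE. Qed.

Fact presented_1mul : right_id presented_one presented_mul.
Proof. by move=> x; rewrite -[x]reprK presented_mulE cats0. Qed.

Fact presented_mulV : left_inverse presented_one presented_inv presented_mul.
Proof.
move=> x; rewrite -[x]reprK presented_invE presented_mulE.
by apply: presented_eq; exact: wc_inv_r.
Qed.

Fact presented_Vmul : right_inverse presented_one presented_inv presented_mul.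
Proof.
move=> x; rewrite -[x]reprK presented_invE presented_mulE.
by apply: presented_eq; exact: wc_inv_l.
Qed.

HB.instance Definition _ := isGroup.Build presented presented_mulA
  presented_mul1 presented_1mul presented_mulV presented_Vmul.

Definition presented_gen (x : X) : presented := \pi_presented [:: (x, true)].

Section UniversalProperty.
Variables (G : groupType) (f : X -> G).

Definition word_eval w : G :=
  foldr (fun l y => (if l.2 then f l.1 else (f l.1)^-1) * y) 1 w.

Lemma word_eval_cat w w' : word_eval (w ++ w') = word_eval w * word_eval w'.
Proof. by elim: w => [|l w IH] /=; rewrite ?mul1g // IH mulgA. Qed.

Definition presented_lift (x : presented) : G := word_eval (repr x).

Hypothesis f_rel : forall w w', rel w w' -> word_eval w = word_eval w'.

Lemma word_eval_congr w w' : word_congr w w' -> word_eval w = word_eval w'.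
Proof.
elim=> {w w'} //.
- by move=> w1 w2 w3 _ -> _ ->.
- by move=> u v w w' _ IH; rewrite !word_eval_cat IH.
- by move=> x [] /=; rewrite mulg1 ?mulgV ?mulVg.
Qed.

Lemma presented_liftE w : presented_lift (\pi_presented w) = word_eval w.
Proof. by apply: word_eval_congr; exact: presented_repr. Qed.

Lemma presented_lift_gen x : presented_lift (presented_gen x) = f x.
Proof. by rewrite presented_liftE /= mulg1. Qed.

Lemma presented_lift_morphism : monoid.monoid_morphism presented_lift.
Proof.
split=> [|x y]; first by rewrite presented_liftE.
by rewrite -[x]reprK -[y]reprK [_ * _]presented_mulE !presented_liftE word_eval_cat.
Qed.

End UniversalProperty.

Lemma presented_ind (P : presented -> Prop) :
    P 1 -> (forall x y, P y -> P (presented_gen x * y)) ->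
    (forall x y, P y -> P ((presented_gen x)^-1 * y)) ->
  forall y, P y.
Proof.
move=> P1 Pg Pv y; rewrite -[y]reprK; elim: (repr y) => [//|[x b] w IH].
have -> : \pi_presented ((x, b) :: w) =
   (if b then presented_gen x else (presented_gen x)^-1) * \pi_presented w.
  case: b; rewrite /presented_gen.
    by rewrite [RHS]presented_mulE.
  by rewrite [X in X * _]presented_invE [RHS]presented_mulE.
by case: b; [exact: Pg | exact: Pv].
Qed.

End PresentedGroup.

Local Open Scope group_scope.

Section Braid.
Variable n : nat.

(* Indices start at 0: i : 'I_n.-1 stands for the generator sigma_(i+1), which
   exchanges the strands i and i + 1 of 'I_n. *)
Definition strand (i : 'I_n.-1) : 'I_n := widen_ord (leq_pred n) i.

Fact next_strand_subproof (i : 'I_n.-1) : (i.+1 < n)%N.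
Proof. by case: n i => [|m] [i hi]. Qed.
Definition next_strand (i : 'I_n.-1) : 'I_n := Ordinal (next_strand_subproof i).

Inductive braid_rel : seq ('I_n.-1 * bool) -> seq ('I_n.-1 * bool) -> Prop :=
| braid_far (i j : 'I_n.-1) : (i.+1 < j)%N ->
    braid_rel [:: (i, true); (j, true)] [:: (j, true); (i, true)]
| braid_near (i j : 'I_n.-1) : i.+1 = j :> nat ->
    braid_rel [:: (i, true); (j, true); (i, true)]
              [:: (j, true); (i, true); (j, true)].

Definition braid := presented braid_rel.
HB.instance Definition _ := Group.on braid.

Definition braid_gen (i : 'I_n.-1) : braid := presented_gen braid_rel i.

Definition strand_swap (i : 'I_n.-1) : 'S_n := tperm (strand i) (next_strand i).

Fact strand_swap_rel w w' :
  braid_rel w w' -> word_eval strand_swap w = word_eval strand_swap w'.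
Proof.
case=> i j hij /=; rewrite !mulg1.
  rewrite [RHS](_ : _ = strand_swap i * strand_swap j ^ strand_swap i); last first.
    by rewrite -conjgC.
  congr (_ * _); rewrite /strand_swap tpermJ !tpermD // -val_eqE /= ltn_eqF //.
  - exact: leqW (ltnW hij).
  - exact: leqW hij.
  - exact: ltnW hij.
have ne1 : strand i != next_strand j.
  by rewrite -val_eqE /= -hij ltn_eqF // leqW.
have ne2 : strand i != strand j by rewrite -val_eqE /= -hij ltn_eqF.
have ne3 : strand j != next_strand j by rewrite -val_eqE /= ltn_eqF.
have e : next_strand i = strand j by apply: val_inj.
have -> : strand_swap i * (strand_swap j * strand_swap i) = strand_swap j ^ strand_swap i.
  by rewrite conjgE /strand_swap tpermV.
have -> : strand_swap j * (strand_swap i * strand_swap j) = strand_swap i ^ strand_swap j.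
  by rewrite conjgE /strand_swap tpermV.
rewrite /strand_swap !tpermJ e !tpermR tpermL.
by rewrite !tpermD // eq_sym.
Qed.

Definition braid_perm : braid -> 'S_n :=
  @presented_lift _ braid_rel _ strand_swap.

HB.instance Definition _ := isUMagmaMorphism.Build braid 'S_n braid_perm
  (presented_lift_morphism strand_swap_rel).

Lemma braid_perm_gen i : braid_perm (braid_gen i) = strand_swap i.
Proof. exact: (presented_lift_gen strand_swap_rel). Qed.

End Braid.

Section BraidIncl.
Variable n : nat.

Definition braid_gen_incl (i : 'I_n.-1) : braid n.+1 :=
  braid_gen (strand i : 'I_(n.+1).-1).

Fact braid_gen_incl_rel w w' : @braid_rel n w w' ->
  word_eval braid_gen_incl w = word_eval braid_gen_incl w'.
Proof.
have E v : word_eval braid_gen_incl v =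
   \pi_(presented (@braid_rel n.+1)) [seq (strand l.1, l.2) | l <- v].
  elim: v => [//|[i b] v IH] /=; rewrite IH.
  case: b; first by rewrite [LHS]presented_mulE.
  rewrite [X in X * _ = _]presented_invE.
  by rewrite [LHS]presented_mulE.
by case=> i j hij; rewrite !E; apply: presented_eq; apply: wc_rel; constructor.
Qed.

Definition braid_incl : braid n -> braid n.+1 :=
  @presented_lift _ (@braid_rel n) _ braid_gen_incl.

HB.instance Definition _ := isUMagmaMorphism.Build (braid n) (braid n.+1)
  braid_incl (presented_lift_morphism braid_gen_incl_rel).

Lemma braid_incl_gen (i : 'I_n.-1) :
  braid_incl (braid_gen i) = braid_gen (strand i : 'I_(n.+1).-1).
Proof. exact: (presented_lift_gen braid_gen_incl_rel). Qed.

End BraidIncl.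

(* The group 'I_d.-1.+1 is Z/dZ, written additively, for every d >= 1
   (including d = 1, where 'Z_d would be Z/2Z). *)
Section Framed.
Variables d n : nat.

Definition frame := {ffun 'I_n -> 'I_d.-1.+1}.
HB.instance Definition _ := GRing.Zmodule.on frame.

Record framed_braid := FramedBraid { frame_of : frame; braid_of : braid n }.

Definition framed_braid_pair x := (frame_of x, braid_of x).
Definition pair_framed_braid p := FramedBraid p.1 p.2.
Fact framed_braid_pairK : cancel framed_braid_pair pair_framed_braid.
Proof. by case. Qed.
HB.instance Definition _ := Choice.copy framed_braid (can_type framed_braid_pairK).

(* Products in 'S_n are read from left to right, hence composing frames on
   the right with permutations is a left action; it takes the frame supported
   at strand j to the one supported at strand s^-1 j. *)
Definition frame_act (s : 'S_n) (a : frame) : frame := [ffun j => a (s j)].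

Definition framed_mul x y := FramedBraid
  (frame_of x + frame_act (braid_perm (braid_of x)) (frame_of y))%R
  (braid_of x * braid_of y).
Definition framed_one := FramedBraid 0%R 1.
Definition framed_inv x := FramedBraid
  (- frame_act (braid_perm (braid_of x))^-1 (frame_of x))%R (braid_of x)^-1.

Fact framed_mulA : associative framed_mul.
Proof.
move=> [a s] [b t] [c r]; rewrite /framed_mul /= mulgA; congr FramedBraid.
by apply/ffunP=> j; rewrite !ffunE addrA gmulfM permM.
Qed.

Fact framed_mul1 : left_id framed_one framed_mul.
Proof.
move=> [a s]; rewrite /framed_mul /= mul1g; congr FramedBraid.
by apply/ffunP=> j; rewrite !ffunE gmulf1 perm1 add0r.
Qed.

Fact framed_1mul : right_id framed_one framed_mul.
Proof.
move=> [a s]; rewrite /framed_mul /= mulg1; congr FramedBraid.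
by apply/ffunP=> j; rewrite !ffunE addr0.
Qed.

Fact framed_mulV : left_inverse framed_one framed_inv framed_mul.
Proof.
move=> [a s]; rewrite /framed_mul /= mulVg; congr FramedBraid.
by apply/ffunP=> j; rewrite !ffunE gmulfV addNr.
Qed.

Fact framed_Vmul : right_inverse framed_one framed_inv framed_mul.
Proof.
move=> [a s]; rewrite /framed_mul /= mulgV; congr FramedBraid.
by apply/ffunP=> j; rewrite !ffunE permK addrN.
Qed.

HB.instance Definition _ := isGroup.Build framed_braid framed_mulA framed_mul1
  framed_1mul framed_mulV framed_Vmul.

Definition frame_gen (i : 'I_n) : framed_braid :=
  FramedBraid [ffun j => if j == i then inZp 1 else 0%R] 1.
Definition sigma_gen (i : 'I_n.-1) : framed_braid :=
  FramedBraid 0%R (braid_gen i).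

End Framed.

Section FramedIncl.
Variables d n : nat.

Definition frame_incl (a : frame d n) : frame d n.+1 :=
  [ffun j => if unlift ord_max j is Some i then a i else 0%R].

Definition framed_incl (x : framed_braid d n) : framed_braid d n.+1 :=
  FramedBraid (frame_incl (frame_of x)) (braid_incl (braid_of x)).

Lemma braid_perm_incl (s : braid n) :
  (forall i, braid_perm (braid_incl s) (lift ord_max i) =
             lift ord_max (braid_perm s i)) /\
  braid_perm (braid_incl s) ord_max = ord_max.
Proof.
have E (i : 'I_n.-1) : strand_swap (strand i : 'I_(n.+1).-1) =
    tperm (lift ord_max (strand i)) (lift ord_max (next_strand i)).
  by congr tperm; apply: val_inj; rewrite /= /bump leqNgt;
     rewrite ?(ltn_ord (strand i)) // (ltn_ord (next_strand i)).
have H (i : 'I_n.-1) (x : braid n) :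
  ((forall j, braid_perm (braid_incl x) (lift ord_max j) =
             lift ord_max (braid_perm x j)) /\
  braid_perm (braid_incl x) ord_max = ord_max) ->
  (forall j, braid_perm (braid_incl (braid_gen i * x)) (lift ord_max j) =
             lift ord_max (braid_perm (braid_gen i * x) j)) /\
  braid_perm (braid_incl (braid_gen i * x)) ord_max = ord_max.
  move=> [h1 h2]; split=> [j|]; rewrite !gmulfM !permM /= braid_incl_gen !braid_perm_gen E.
    by rewrite -(inj_tperm _ _ _ (@lift_inj _ ord_max)) h1.
  by rewrite tpermD // eq_sym neq_lift.
have HV (i : 'I_n.-1) (x : braid n) :
  ((forall j, braid_perm (braid_incl x) (lift ord_max j) =
             lift ord_max (braid_perm x j)) /\
  braid_perm (braid_incl x) ord_max = ord_max) ->
  (forall j, braid_perm (braid_incl ((braid_gen i)^-1 * x)) (lift ord_max j) =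
             lift ord_max (braid_perm ((braid_gen i)^-1 * x) j)) /\
  braid_perm (braid_incl ((braid_gen i)^-1 * x)) ord_max = ord_max.
  move=> [h1 h2]; split=> [j|];
    rewrite !gmulfM !gmulfV !permM /= braid_incl_gen !braid_perm_gen E /strand_swap !tpermV.
    by rewrite -(inj_tperm _ _ _ (@lift_inj _ ord_max)) h1.
  by rewrite tpermD // eq_sym neq_lift.
elim/presented_ind: s => [|i x|i x]; last 2 first.
- exact: H.
- exact: HV.
by split=> [j|]; rewrite !gmulf1 !perm1.
Qed.

Fact framed_incl_morphism : monoid.monoid_morphism framed_incl.
Proof.
split=> [|[a s] [b t]]; rewrite /framed_incl.
  congr FramedBraid; last exact: gmulf1.
  by apply/ffunP=> j; rewrite !ffunE; case: unliftP => // i _; rewrite ffunE.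
congr FramedBraid; last exact: gmulfM.
have [h1 h2] := braid_perm_incl s.
apply/ffunP=> j; rewrite !ffunE /=; case: unliftP => [i ->|->].
  by rewrite h1 liftK !ffunE.
by rewrite h2 unlift_none addr0.
Qed.
HB.instance Definition _ := isUMagmaMorphism.Build
  (framed_braid d n) (framed_braid d n.+1) framed_incl framed_incl_morphism.

Lemma framed_incl_frame (i : 'I_n) :
  framed_incl (frame_gen d i) = frame_gen d (lift ord_max i).
Proof.
congr FramedBraid; last exact: gmulf1.
apply/ffunP=> j; rewrite !ffunE; case: unliftP => [k ->|->].
  by rewrite ffunE (inj_eq (@lift_inj _ ord_max)).
by rewrite (negbTE (neq_lift _ _)).
Qed.

Lemma framed_incl_sigma (i : 'I_n.-1) :
  framed_incl (sigma_gen d i) = sigma_gen d (strand i : 'I_(n.+1).-1).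
Proof.
congr FramedBraid; last exact: braid_incl_gen.
by apply/ffunP=> j; rewrite !ffunE; case: unliftP => // i' _; rewrite ffunE.
Qed.

End FramedIncl.

Section FramedMod.
Variables (d d' n : nat) (d_gt0 : (0 < d)%N) (d'd : (d' %| d)%N).

Definition frame_mod (a : frame d n) : frame d' n := [ffun j => inZp (a j)].

Definition framed_mod (_ : (0 < d)%N) (_ : (d' %| d)%N) (x : framed_braid d n) :
    framed_braid d' n :=
  FramedBraid (frame_mod (frame_of x)) (braid_of x).

Fact d'_dvd : (d'.-1.+1 %| d.-1.+1)%N.
Proof. by rewrite !prednK // (dvdn_gt0 d_gt0). Qed.

Fact framed_mod_morphism : monoid.monoid_morphism (framed_mod d_gt0 d'd).
Proof.
split=> [|[a s] [b t]]; rewrite /framed_mod.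
  by congr FramedBraid; apply/ffunP=> j; rewrite !ffunE; apply: val_inj; rewrite /= mod0n.
congr FramedBraid; apply/ffunP=> j; rewrite !ffunE; apply: val_inj => /=.
by rewrite modnDm modn_dvdm // d'_dvd.
Qed.
HB.instance Definition _ := isUMagmaMorphism.Build
  (framed_braid d n) (framed_braid d' n) (framed_mod d_gt0 d'd)
  framed_mod_morphism.

Lemma framed_mod_frame (i : 'I_n) :
  framed_mod d_gt0 d'd (frame_gen d i) = frame_gen d' i.
Proof.
congr FramedBraid; apply/ffunP=> j; rewrite !ffunE.
by case: eqP => _; apply: val_inj; rewrite /= ?mod0n // modn_dvdm // d'_dvd.
Qed.

Lemma framed_mod_sigma (i : 'I_n.-1) :
  framed_mod d_gt0 d'd (sigma_gen d i) = sigma_gen d' i.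
Proof.
congr FramedBraid; apply/ffunP=> j; rewrite !ffunE.
by apply: val_inj; rewrite /= mod0n.
Qed.

End FramedMod.

Local Close Scope group_scope.
Local Open Scope ring_scope.

Section GroupAlgebra.
Variables (K : comNzRingType) (G : groupType).

(* The ring structure of malg itself asks for an index monoid without
   non-trivial units, which excludes groups; only its module structure is
   reused. *)
Definition galg := {malg K[G]}.
HB.instance Definition _ := GRing.Lmodule.on galg.

Definition galg_of (g : G) : galg := << g >>.

Section Lift.
Variables (V : lmodType K) (f : G -> V).

Definition galg_lift (x : galg) : V := \sum_(g <- msupp x) mcoeff g x *: f g.

Lemma galg_liftEw (x : galg) (S : {fset G}) : (msupp x `<=` S)%fset ->
  galg_lift x = \sum_(g <- S) mcoeff g x *: f g.
Proof.
move=> sxS; rewrite /galg_lift (big_fset_incl _ sxS) //= => g _.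
by move=> /mcoeff_outdom ->; rewrite scale0r.
Qed.

Fact galg_lift_linear : linear galg_lift.
Proof.
move=> a x y; pose S := (msupp x `|` msupp y)%fset.
rewrite (@galg_liftEw (a *: x + y) S); last first.
  apply/fsubsetP => g; rewrite /S in_fsetU -!mcoeff_neq0 mcoeffD mcoeffZ.
  case: (eqVneq (mcoeff g x) 0) => [->|//].
  by case: (eqVneq (mcoeff g y) 0) => [->|//]; rewrite mulr0 addr0 eqxx.
rewrite (@galg_liftEw x S) ?fsubsetUl // (@galg_liftEw y S) ?fsubsetUr //.
rewrite scaler_sumr -big_split; apply: eq_bigr => g _ /=.
by rewrite mcoeffD mcoeffZ scalerDl scalerA.
Qed.
HB.instance Definition _ := GRing.isLinear.Build K galg V _ galg_lift
  galg_lift_linear.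

Lemma galg_liftU g : galg_lift (galg_of g) = f g.
Proof.
rewrite (galg_liftEw msuppU_le) big_seq_fset1.
by rewrite /galg_of mcoeffUU scale1r.
Qed.

End Lift.

Lemma galg_ext (V : lmodType K) (f f' : galg -> V) : linear f -> linear f' ->
  (forall g, f (galg_of g) = f' (galg_of g)) -> f =1 f'.
Proof.
move=> fL f'L ff' x.
pose F : {linear galg -> V} := HB.pack f (GRing.isLinear.Build K galg V _ f fL).
pose F' : {linear galg -> V} :=
  HB.pack f' (GRing.isLinear.Build K galg V _ f' f'L).
rewrite -[LHS]/(F x) -[RHS]/(F' x) (monalgE x) !linear_sum.
apply: eq_bigr => g _ /=.
have -> : << mcoeff g x *g g >> = mcoeff g x *: galg_of g :> galg.
  by apply/malgP=> h; rewrite mcoeffZ !mcoeffU mulr_natr.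
rewrite -[LHS]/(F _) -[RHS]/(F' _) !linearZ /=; congr (_ *: _); exact: ff'.
Qed.

Definition galg_mul (x y : galg) : galg :=
  galg_lift (fun g => galg_lift (fun h => galg_of (g * h)%g) y) x.

Lemma galg_mulU g h : galg_mul (galg_of g) (galg_of h) = galg_of (g * h)%g.
Proof. by rewrite /galg_mul !galg_liftU. Qed.

Fact galg_mul_linl y : linear (galg_mul^~ y).
Proof. by move=> a x x'; rewrite /galg_mul linearP. Qed.

Fact galg_mul_linr x : linear (galg_mul x).
Proof.
move=> a y y'; rewrite /galg_mul /galg_lift scaler_sumr -big_split.
apply: eq_bigr => g _ /=; rewrite -!/(galg_lift _ _) linearP scalerDr.
by rewrite !scalerA mulrC.
Qed.

Fact galg_mulA : associative galg_mul.
Proof.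
move=> x y z; move: z.
apply: galg_ext => [a u v|a u v|k]; rewrite ?galg_mul_linr //.
move: y; apply: galg_ext => [a u v|a u v|h];
  rewrite ?galg_mul_linl ?galg_mul_linr ?galg_mul_linl //.
move: x; apply: galg_ext => [a u v|a u v|g]; rewrite ?galg_mul_linl //.
by rewrite !galg_mulU mulgA.
Qed.

Fact galg_mul1 : left_id (galg_of 1%g) galg_mul.
Proof.
apply: galg_ext => [a u v|//|g]; first exact: galg_mul_linr.
by rewrite galg_mulU mul1g.
Qed.

Fact galg_1mul : right_id (galg_of 1%g) galg_mul.
Proof.
apply: galg_ext => [a u v|//|g]; first exact: galg_mul_linl.
by rewrite galg_mulU mulg1.
Qed.

Fact galg_mulDl : left_distributive galg_mul +%R.
Proof. by move=> x y z; have := galg_mul_linl z 1 x y; rewrite !scale1r. Qed.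

Fact galg_mulDr : right_distributive galg_mul +%R.
Proof. by move=> x y z; have := galg_mul_linr x 1 y z; rewrite !scale1r. Qed.

Fact galg_1neq0 : galg_of 1%g != 0.
Proof.
by apply/eqP => /malgP/(_ 1%g)/eqP; rewrite mcoeffUU mcoeff0 oner_eq0.
Qed.

HB.instance Definition _ := GRing.Zmodule_isNzRing.Build galg galg_mulA
  galg_mul1 galg_1mul galg_mulDl galg_mulDr galg_1neq0.

Fact galg_scaleAl (a : K) (x y : galg) : a *: (x * y) = (a *: x) * y.
Proof.
rewrite -[RHS]/(galg_mul (a *: x) y) -[a *: x]addr0.
by rewrite galg_mul_linl -[galg_mul 0 y]/(0 * y) mul0r addr0.
Qed.
HB.instance Definition _ := GRing.Lmodule_isLalgebra.Build K galg galg_scaleAl.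

Fact galg_scaleAr (a : K) (x y : galg) : a *: (x * y) = x * (a *: y).
Proof.
rewrite -[RHS]/(galg_mul x (a *: y)) -[a *: y]addr0.
by rewrite galg_mul_linr -[galg_mul x 0]/(x * 0) mulr0 addr0.
Qed.
HB.instance Definition _ := GRing.Lalgebra_isAlgebra.Build K galg galg_scaleAr.

Lemma galg_of1 : galg_of 1%g = 1. Proof. by []. Qed.
Lemma galg_ofM g h : galg_of (g * h)%g = galg_of g * galg_of h.
Proof. exact: esym (galg_mulU _ _). Qed.

Section LiftMorphism.
Variables (A : algType K) (f : G -> A).
Hypotheses (f1 : f 1%g = 1) (fM : forall g h, f (g * h)%g = f g * f h).

Lemma galg_lift_monoid : GRing.monoid_morphism (galg_lift f).
Proof.
split=> [|x y]; first by rewrite galg_liftU.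
move: y; apply: galg_ext => [a u v|a u v|h].
- by rewrite mulrDr -scalerAr linearP.
- by rewrite linearP mulrDr -scalerAr.
move: x; apply: galg_ext => [a u v|a u v|g].
- by rewrite mulrDl -scalerAl linearP.
- by rewrite linearP mulrDl -scalerAl.
by rewrite -galg_ofM !galg_liftU fM.
Qed.
End LiftMorphism.

End GroupAlgebra.

Section GroupAlgebraMap.
Variables (K : comNzRingType) (G H : groupType) (f : UMagmaMorphism.type G H).

Definition galg_map : galg K G -> galg K H := galg_lift (fun g => galg_of K (f g)).

HB.instance Definition _ := GRing.Linear.copy galg_map
  (galg_lift (fun g => galg_of K (f g))).

Fact galg_map_monoid : GRing.monoid_morphism galg_map.
Proof.
by apply: galg_lift_monoid => [|g h]; rewrite ?gmulf1 // gmulfM galg_ofM.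
Qed.
HB.instance Definition _ := GRing.isMonoidMorphism.Build
  (galg K G) (galg K H) galg_map galg_map_monoid.

Lemma galg_map_of g : galg_map (galg_of K g) = galg_of K (f g).
Proof. exact: galg_liftU. Qed.

End GroupAlgebraMap.

Section IdealQuotient.
Variables (K : comNzRingType) (A : algType K) (S : A -> Prop).

Inductive ideal_gen : A -> Prop :=
| ideal_gen0 : ideal_gen 0
| ideal_genD x y : ideal_gen x -> ideal_gen y -> ideal_gen (x + y)
| ideal_genM a s b : S s -> ideal_gen (a * s * b).

Lemma ideal_gen_sub s : S s -> ideal_gen s.
Proof. by move=> Ss; rewrite -[s]mul1r -[_ * s]mulr1; apply: ideal_genM. Qed.

Lemma ideal_gen_mull a x : ideal_gen x -> ideal_gen (a * x).
Proof.
elim=> {x} [|x y _ IHx _ IHy|b s c Ss].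
- by rewrite mulr0; exact: ideal_gen0.
- by rewrite mulrDr; exact: ideal_genD.
- by rewrite !mulrA; exact: ideal_genM.
Qed.

Lemma ideal_gen_mulr a x : ideal_gen x -> ideal_gen (x * a).
Proof.
elim=> {x} [|x y _ IHx _ IHy|b s c Ss].
- by rewrite mul0r; exact: ideal_gen0.
- by rewrite mulrDl; exact: ideal_genD.
- by rewrite -mulrA; exact: ideal_genM.
Qed.

Lemma ideal_genN x : ideal_gen x -> ideal_gen (- x).
Proof. by move=> Ix; rewrite -mulN1r; exact: ideal_gen_mull. Qed.

Lemma ideal_genZ c x : ideal_gen x -> ideal_gen (c *: x).
Proof. by move=> Ix; rewrite -mulr_algl; exact: ideal_gen_mull. Qed.

Definition ideal_eqb (x y : A) : bool := `[< ideal_gen (x - y) >].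

Fact ideal_eqb_refl : reflexive ideal_eqb.
Proof. by move=> x; apply/asboolP; rewrite subrr; exact: ideal_gen0. Qed.

Fact ideal_eqb_sym : symmetric ideal_eqb.
Proof.
by move=> x y; apply/asboolP/asboolP => /ideal_genN; rewrite opprB.
Qed.

Fact ideal_eqb_trans : transitive ideal_eqb.
Proof.
move=> y x z /asboolP h1 /asboolP h2; apply/asboolP.
by rewrite -(subrKA y); exact: ideal_genD.
Qed.

Canonical ideal_equiv :=
  EquivRel ideal_eqb ideal_eqb_refl ideal_eqb_sym ideal_eqb_trans.

Definition idealq := {eq_quot ideal_equiv}.
HB.instance Definition _ := Choice.on idealq.
HB.instance Definition _ := EqQuotient.on idealq.

Definition idealq_pi (x : A) : idealq := \pi_idealq x.

Lemma idealq_eqP x y : reflect (ideal_gen (x - y)) (idealq_pi x == idealq_pi y).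
Proof. by rewrite /idealq_pi eqmodE; exact: asboolP. Qed.

Lemma idealq_eq x y : ideal_gen (x - y) -> idealq_pi x = idealq_pi y.
Proof. by move=> h; apply/eqP/idealq_eqP. Qed.

Lemma idealq_reprK x : idealq_pi (repr x) = x.
Proof. exact: reprK. Qed.

Lemma idealq_repr x : ideal_gen (repr (idealq_pi x) - x).
Proof. by apply/idealq_eqP; rewrite idealq_reprK. Qed.

Lemma idealqW (P : idealq -> Prop) : (forall x, P (idealq_pi x)) -> forall q, P q.
Proof. by move=> h q; rewrite -[q]idealq_reprK. Qed.

Definition idealq_add (p q : idealq) : idealq := idealq_pi (repr p + repr q).
Definition idealq_opp (p : idealq) : idealq := idealq_pi (- repr p).
Definition idealq_mul (p q : idealq) : idealq := idealq_pi (repr p * repr q).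
Definition idealq_scale (c : K) (p : idealq) : idealq := idealq_pi (c *: repr p).

Lemma idealq_addE x y :
  idealq_add (idealq_pi x) (idealq_pi y) = idealq_pi (x + y).
Proof.
by apply: idealq_eq; rewrite opprD addrACA; apply: ideal_genD; exact: idealq_repr.
Qed.

Lemma idealq_oppE x : idealq_opp (idealq_pi x) = idealq_pi (- x).
Proof.
by apply: idealq_eq; rewrite -opprD; apply: ideal_genN; exact: idealq_repr.
Qed.

Lemma idealq_mulE x y :
  idealq_mul (idealq_pi x) (idealq_pi y) = idealq_pi (x * y).
Proof.
apply: idealq_eq; set x' := repr _; set y' := repr _.
have -> : x' * y' - x * y = (x' - x) * y' + x * (y' - y).
  by rewrite mulrBl mulrBr subrKA.
apply: ideal_genD; first by apply: ideal_gen_mulr; exact: idealq_repr.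
by apply: ideal_gen_mull; exact: idealq_repr.
Qed.

Lemma idealq_scaleE c x : idealq_scale c (idealq_pi x) = idealq_pi (c *: x).
Proof.
by apply: idealq_eq; rewrite -scalerBr; apply: ideal_genZ; exact: idealq_repr.
Qed.

Fact idealq_addA : associative idealq_add.
Proof.
elim/idealqW=> x; elim/idealqW=> y; elim/idealqW=> z.
by rewrite (idealq_addE y) (idealq_addE x y) !idealq_addE addrA.
Qed.
Fact idealq_addC : commutative idealq_add.
Proof.
by elim/idealqW=> x; elim/idealqW=> y; rewrite (idealq_addE x) (idealq_addE y) addrC.
Qed.
Fact idealq_add0 : left_id (idealq_pi 0) idealq_add.
Proof. by elim/idealqW=> x; rewrite idealq_addE add0r. Qed.
Fact idealq_addN : left_inverse (idealq_pi 0) idealq_opp idealq_add.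
Proof. by elim/idealqW=> x; rewrite idealq_oppE idealq_addE addNr. Qed.

HB.instance Definition _ := GRing.isZmodule.Build idealq
  idealq_addA idealq_addC idealq_add0 idealq_addN.

Fact idealq_mulA : associative idealq_mul.
Proof.
elim/idealqW=> x; elim/idealqW=> y; elim/idealqW=> z.
by rewrite (idealq_mulE y) (idealq_mulE x y) !idealq_mulE mulrA.
Qed.
Fact idealq_mul1 : left_id (idealq_pi 1) idealq_mul.
Proof. by elim/idealqW=> x; rewrite idealq_mulE mul1r. Qed.
Fact idealq_1mul : right_id (idealq_pi 1) idealq_mul.
Proof. by elim/idealqW=> x; rewrite idealq_mulE mulr1. Qed.
Fact idealq_mulDl : left_distributive idealq_mul +%R.
Proof.
elim/idealqW=> x; elim/idealqW=> y; elim/idealqW=> z.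
rewrite [_ + _]idealq_addE idealq_mulE (idealq_mulE x) (idealq_mulE y) mulrDl.
exact: esym (idealq_addE _ _).
Qed.
Fact idealq_mulDr : right_distributive idealq_mul +%R.
Proof.
elim/idealqW=> x; elim/idealqW=> y; elim/idealqW=> z.
rewrite [_ + _]idealq_addE idealq_mulE (idealq_mulE x y) (idealq_mulE x z) mulrDr.
exact: esym (idealq_addE _ _).
Qed.

HB.instance Definition _ := GRing.Zmodule_isPzRing.Build idealq
  idealq_mulA idealq_mul1 idealq_1mul idealq_mulDl idealq_mulDr.

Fact idealq_scaleA a b x :
  idealq_scale a (idealq_scale b x) = idealq_scale (a * b) x.
Proof.
by elim/idealqW: x => x; rewrite (idealq_scaleE b) !idealq_scaleE scalerA.
Qed.
Fact idealq_scale1 : left_id 1 idealq_scale.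
Proof. by elim/idealqW=> x; rewrite idealq_scaleE scale1r. Qed.
Fact idealq_scaleDr : right_distributive idealq_scale +%R.
Proof.
move=> c; elim/idealqW=> x; elim/idealqW=> y.
rewrite [_ + _]idealq_addE idealq_scaleE (idealq_scaleE _ x) (idealq_scaleE _ y).
by rewrite scalerDr; exact: esym (idealq_addE _ _).
Qed.
Fact idealq_scaleDl x : {morph idealq_scale^~ x : a b / a + b}.
Proof.
move=> a b; elim/idealqW: x => x /=.
rewrite idealq_scaleE (idealq_scaleE a) (idealq_scaleE b) scalerDl.
exact: esym (idealq_addE _ _).
Qed.

HB.instance Definition _ := GRing.Zmodule_isLmodule.Build K idealq
  idealq_scaleA idealq_scale1 idealq_scaleDr idealq_scaleDl.

Lemma idealq_piD x y : idealq_pi (x + y) = idealq_pi x + idealq_pi y.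
Proof. exact: esym (idealq_addE _ _). Qed.
Lemma idealq_piM x y : idealq_pi (x * y) = idealq_pi x * idealq_pi y.
Proof. exact: esym (idealq_mulE _ _). Qed.
Lemma idealq_piZ c x : idealq_pi (c *: x) = c *: idealq_pi x.
Proof. exact: esym (idealq_scaleE _ _). Qed.
Lemma idealq_pi1 : idealq_pi 1 = 1. Proof. by []. Qed.
Lemma idealq_pi0 : idealq_pi 0 = 0. Proof. by []. Qed.

Lemma ideal_gen_morph (B : nzRingType) (f : {rmorphism A -> B}) x :
  (forall s, S s -> f s = 0) -> ideal_gen x -> f x = 0.
Proof.
move=> fS; elim=> {x} [|x y _ IHx _ IHy|a s b Ss]; first exact: rmorph0.
  by rewrite rmorphD IHx IHy addr0.
by rewrite !rmorphM (fS _ Ss) mulr0 mul0r.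
Qed.

Lemma idealq_nontrivial (B : nzRingType) (f : {rmorphism A -> B}) :
  (forall s, S s -> f s = 0) -> (1 : idealq) != 0.
Proof.
move=> fS; apply/negP => /idealq_eqP; rewrite subr0 => /(ideal_gen_morph fS).
by move/eqP; rewrite rmorph1 oner_eq0.
Qed.

Fact idealq_scaleAl c (x y : idealq) : c *: (x * y) = (c *: x) * y.
Proof.
elim/idealqW: x => x; elim/idealqW: y => y.
by rewrite -idealq_piZ -!idealq_piM -idealq_piZ scalerAl.
Qed.
Fact idealq_scaleAr c (x y : idealq) : c *: (x * y) = x * (c *: y).
Proof.
elim/idealqW: x => x; elim/idealqW: y => y.
by rewrite -idealq_piZ -!idealq_piM -idealq_piZ scalerAr.
Qed.

End IdealQuotient.

Section IdealQuotientMap.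
Variables (K : comNzRingType) (A B : algType K) (S : A -> Prop) (T : B -> Prop).
Variable f : {lrmorphism A -> B}.

Definition idealq_map (x : idealq S) : idealq T := idealq_pi T (f (repr x)).

Hypothesis fST : forall s, S s -> ideal_gen T (f s).

Lemma idealq_mapE x : idealq_map (idealq_pi S x) = idealq_pi T (f x).
Proof.
apply: idealq_eq; rewrite -rmorphB.
elim: (idealq_repr S x) => [|y z _ IHy _ IHz|a s b Ss].
- by rewrite rmorph0; exact: ideal_gen0.
- by rewrite rmorphD; exact: ideal_genD.
- by rewrite !rmorphM; apply/ideal_gen_mulr/ideal_gen_mull/fST.
Qed.

Lemma idealq_map_linear : linear idealq_map.
Proof.
move=> c; elim/idealqW=> x; elim/idealqW=> y.
by rewrite -idealq_piZ -idealq_piD !idealq_mapE linearP idealq_piD idealq_piZ.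
Qed.

Lemma idealq_map_monoid : GRing.monoid_morphism idealq_map.
Proof.
split=> [|x y]; first by rewrite -idealq_pi1 idealq_mapE rmorph1.
elim/idealqW: x => x; elim/idealqW: y => y.
by rewrite -idealq_piM !idealq_mapE rmorphM idealq_piM.
Qed.

End IdealQuotientMap.

Arguments galg_map K {G H} f.

Lemma quadratic_rel_vanish (K : comNzRingType) (A : algType K) (B : nzRingType)
    (f : {rmorphism A -> B}) (c : K) (s e : A) :
  f s = 1 -> f (s ^+ 2 - 1 - c *: (e * (1 - s))) = 0.
Proof.
move=> fs; rewrite -mulr_algl !(rmorphB, rmorphM, rmorphXn, rmorph1) fs.
by rewrite ?expr1n ?mulr1 !subrr !mulr0 subrr.
Qed.

Section YokonumaHecke.
Variables (K : numFieldType) (u : K) (d n : nat).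

Local Notation F := (framed_braid d n).

(* The idempotent usually written e_{d,i}. *)
Definition frame_idem (i : 'I_n.-1) : galg K F :=
  d%:R^-1 *: \sum_(1 <= m < d.+1) galg_of K
    (frame_gen d (strand i) ^+ m * frame_gen d (next_strand i) ^- m)%g.

Definition yh_relator (i : 'I_n.-1) : galg K F :=
  let s := galg_of K (sigma_gen d i) in
  s ^+ 2 - 1 - (u - 1) *: (frame_idem i * (1 - s)).

Definition yh_relators (x : galg K F) : Prop := exists i, x = yh_relator i.

Definition yh := idealq yh_relators.
HB.instance Definition _ := GRing.PzRing.on yh.
HB.instance Definition _ := GRing.Lmodule.on yh.

Definition augmentation : galg K F -> K := galg_lift (fun=> 1 : K^o).
Fact augmentation_monoid : GRing.monoid_morphism augmentation.
Proof. by apply: (@galg_lift_monoid K F K^o) => // g h; rewrite mulr1. Qed.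
HB.instance Definition _ := GRing.Linear.copy augmentation
  (galg_lift (fun=> 1 : K^o)).
HB.instance Definition _ := GRing.isMonoidMorphism.Build (galg K F) K
  augmentation augmentation_monoid.

Lemma augmentation_of g : augmentation (galg_of K g) = 1.
Proof. exact: (@galg_liftU K F K^o (fun=> 1) g). Qed.

Fact augmentation_relator (x : galg K F) : yh_relators x -> augmentation x = 0.
Proof.
by move=> [i ->]; apply: (@quadratic_rel_vanish _ _ _ augmentation); exact: augmentation_of.
Qed.

Fact yh_1neq0 : (1 : yh) != 0.
Proof. exact: (idealq_nontrivial augmentation_relator). Qed.

HB.instance Definition _ := GRing.PzSemiRing_isNonZero.Build yh yh_1neq0.
HB.instance Definition _ := GRing.Lmodule_isLalgebra.Build K yh
  (@idealq_scaleAl _ _ yh_relators).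
HB.instance Definition _ := GRing.Lalgebra_isAlgebra.Build K yh
  (@idealq_scaleAr _ _ yh_relators).

Definition yh_of (g : F) : yh := idealq_pi yh_relators (galg_of K g).
Definition yh_g (i : 'I_n.-1) : yh := yh_of (sigma_gen d i).
Definition yh_h (i : 'I_n) : yh := yh_of (frame_gen d i).

Lemma yh_of1 : yh_of 1%g = 1. Proof. by []. Qed.
Lemma yh_ofM g h : yh_of (g * h)%g = yh_of g * yh_of h.
Proof. by rewrite /yh_of galg_ofM idealq_piM. Qed.

End YokonumaHecke.

Lemma quadratic_rel_morph (K : comNzRingType) (A B : algType K)
    (f : {lrmorphism A -> B}) (c : K) (s e : A) :
  f (s ^+ 2 - 1 - c *: (e * (1 - s))) =
  f s ^+ 2 - 1 - c *: (f e * (1 - f s)).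
Proof.
have fZ : f (c *: (e * (1 - s))) = c *: f (e * (1 - s)) by exact: linearZZ.
rewrite !rmorphB rmorphXn rmorph1; congr (_ - _).
by apply: etrans fZ _; rewrite rmorphM rmorphB rmorph1.
Qed.

Lemma frame_genX d n (i : 'I_n) m :
  (frame_gen d i ^+ m)%g = FramedBraid [ffun j => if j == i then inZp m else 0] 1%g.
Proof.
elim: m => [|m IH].
  rewrite expg0; congr FramedBraid; apply/ffunP=> j; rewrite !ffunE.
  by case: eqP => // _; apply: val_inj; rewrite /= mod0n.
rewrite expgSr IH; congr FramedBraid; last exact: mulg1.
apply/ffunP=> j; rewrite !ffunE gmulf1 perm1; case: eqP => _; last exact: addr0.
by apply: val_inj; rewrite /= modnDm addn1.
Qed.

Section YHIncl.
Variables (K : numFieldType) (u : K) (d n : nat).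

Fact frame_idem_incl (i : 'I_n.-1) :
  galg_map K (@framed_incl d n) (frame_idem K d i) =
  frame_idem K d (strand i : 'I_(n.+1).-1).
Proof.
apply: etrans (linearZZ (galg_map K (@framed_incl d n)) _ _) _; apply: (congr1 ( *:%R _)).
apply: etrans (linear_sum (galg_map K (@framed_incl d n)) _ _ _) _.
apply: eq_bigr => m _; rewrite /= galg_map_of; congr galg_of.
rewrite gmulfM gmulfXVn gmulfXn /= !framed_incl_frame.
by congr (frame_gen d _ ^+ m * frame_gen d _ ^- m)%g;
  apply: val_inj; rewrite /= /bump leqNgt ?(ltn_ord (strand i)) ?(ltn_ord (next_strand i)).
Qed.

Fact yh_incl_relators (x : galg K (framed_braid d n)) : yh_relators u x ->
  ideal_gen (@yh_relators K u d n.+1) (galg_map K (@framed_incl d n) x).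
Proof.
move=> [i ->]; apply: ideal_gen_sub; exists (strand i : 'I_(n.+1).-1).
rewrite quadratic_rel_morph /= frame_idem_incl galg_map_of /= framed_incl_sigma.
by [].
Qed.

Definition yh_incl : yh u d n -> yh u d n.+1 :=
  @idealq_map _ _ _ _ _ (galg_map K (@framed_incl d n)).

HB.instance Definition _ := GRing.isLinear.Build K (yh u d n) (yh u d n.+1) _
  yh_incl (idealq_map_linear yh_incl_relators).
HB.instance Definition _ := GRing.isMonoidMorphism.Build (yh u d n) (yh u d n.+1)
  yh_incl (idealq_map_monoid yh_incl_relators).

Lemma yh_incl_of g : yh_incl (yh_of u g) = yh_of u (framed_incl g).
Proof. by rewrite [LHS](idealq_mapE yh_incl_relators) /= galg_map_of. Qed.

End YHIncl.

Lemma sum_periodic (V : zmodType) (F : nat -> V) d q :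
  (forall m, F (d + m)%N = F m) ->
  \sum_(1 <= m < (q * d).+1) F m = (\sum_(1 <= m < d.+1) F m) *+ q.
Proof.
move=> Fd; rewrite !big_add1 /=; elim: q => [|q IH]; first by rewrite big_geq.
rewrite mulSn (@big_cat_nat _ _ _ d) //=; last exact: leq_addr.
rewrite mulrS; congr (_ + _); rewrite -IH -{1}[d]add0n big_addn addKn.
by apply: eq_bigr => m _; rewrite -addSn addnC Fd.
Qed.

Section YHProj.
Variables (K : numFieldType) (u : K) (d d' n : nat).
Variables (d_gt0 : (0 < d)%N) (d'd : (d' %| d)%N).

Local Notation pi := (galg_map K (@framed_mod d d' n d_gt0 d'd)).

Fact frame_idem_mod (i : 'I_n.-1) : pi (frame_idem K d i) = frame_idem K d' i.
Proof.
have d'_gt0 : (0 < d')%N := dvdn_gt0 d_gt0 d'd.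
pose F m := galg_of K (frame_gen d' (strand i) ^+ m *
                       frame_gen d' (next_strand i) ^- m)%g.
apply: etrans (linearZZ pi _ _) _.
apply: (@etrans _ _ (d%:R^-1 *: \sum_(1 <= m < d.+1) F m)).
  apply: (congr1 ( *:%R _)); apply: etrans (linear_sum pi _ _ _) _; apply: eq_bigr => m _.
  rewrite /= galg_map_of; congr galg_of.
  by rewrite gmulfM gmulfXVn gmulfXn /= !framed_mod_frame.
have Fper m : F (d' + m)%N = F m.
  have E j : (frame_gen d' j ^+ (d' + m))%g = (frame_gen d' j ^+ m)%g.
    rewrite !frame_genX; congr FramedBraid; apply/ffunP=> k; rewrite !ffunE.
    by case: eqP => // _; apply: val_inj; rewrite /= prednK // modnDl.
  by rewrite /F !E.
have sumF : \sum_(1 <= m < d.+1) F m = (\sum_(1 <= m < d'.+1) F m) *+ (d %/ d').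
  by rewrite -sum_periodic // divnK.
apply: (@etrans _ _ (d'%:R^-1 *: \sum_(1 <= m < d'.+1) F m)); last by [].
rewrite sumF; move: (\sum_(1 <= m < d'.+1) F m) => T.
rewrite -scaler_nat scalerA; apply: (congr1 ( *:%R^~ T)).
rewrite -{1}(divnK d'd) natrM invfM mulrAC mulVf ?mul1r //.
by rewrite pnatr_eq0 -lt0n divn_gt0 // dvdn_leq.
Qed.

Fact yh_proj_relators (x : galg K (framed_braid d n)) : yh_relators u x ->
  ideal_gen (@yh_relators K u d' n) (pi x).
Proof.
move=> [i ->]; apply: ideal_gen_sub; exists i.
by rewrite quadratic_rel_morph /= frame_idem_mod galg_map_of /= framed_mod_sigma.
Qed.

Definition yh_proj : yh u d n -> yh u d' n :=
  @idealq_map _ _ _ _ _ pi.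

HB.instance Definition _ := GRing.isLinear.Build K (yh u d n) (yh u d' n) _
  yh_proj (idealq_map_linear yh_proj_relators).
HB.instance Definition _ := GRing.isMonoidMorphism.Build (yh u d n) (yh u d' n)
  yh_proj (idealq_map_monoid yh_proj_relators).

Lemma yh_proj_of g :
  yh_proj (yh_of u g) = yh_of u (framed_mod d_gt0 d'd g).
Proof. by rewrite [LHS](idealq_mapE yh_proj_relators) /= galg_map_of. Qed.

End YHProj.

Lemma yh_ext (K : numFieldType) (u : K) d n (V : lmodType K) (f f' : yh u d n -> V) :
  linear f -> linear f' -> (forall g, f (yh_of u g) = f' (yh_of u g)) -> f =1 f'.
Proof.
move=> fL f'L ff'; elim/idealqW; apply: galg_ext => [a x y|a x y|//].
  by rewrite idealq_piD idealq_piZ fL.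
by rewrite idealq_piD idealq_piZ f'L.
Qed.

Lemma framed_mod_incl d d' n (d_gt0 : (0 < d)%N) (d'd : (d' %| d)%N)
    (x : framed_braid d n) :
  framed_mod d_gt0 d'd (framed_incl x) = framed_incl (framed_mod d_gt0 d'd x).
Proof.
congr FramedBraid; apply/ffunP=> j; rewrite !ffunE; case: unliftP => [i _|_].
  by rewrite ffunE.
by apply: val_inj; rewrite /= mod0n.
Qed.

Lemma yh_proj_incl (K : numFieldType) (u : K) d d' n (d_gt0 : (0 < d)%N)
    (d'd : (d' %| d)%N) (x : yh u d n) :
  yh_proj d_gt0 d'd (yh_incl x) = yh_incl (yh_proj d_gt0 d'd x).
Proof.
move: x; apply: yh_ext => [a x y|a x y|g]; rewrite ?linearP //.
by rewrite yh_incl_of !yh_proj_of framed_mod_incl yh_incl_of.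
Qed.

Section InverseLimit.
Variables (K : comNzRingType) (A : nat -> algType K).
Variable f : forall r s : nat, (s <= r)%N -> {lrmorphism A r -> A s}.

Definition compatible (x : forall r, A r) : Prop :=
  forall r s (sr : (s <= r)%N), f sr (x r) = x s.

Record invlim := InvLim {
  invlim_seq :> forall r, A r;
  invlim_compat : compatible invlim_seq
}.

Lemma invlimP (x y : invlim) : (forall r, x r = y r) -> x = y.
Proof.
case: x y => [x hx] [y hy] /= xy; have {xy} exy : x = y by apply: functional_extensionality_dep.
by case: _ / exy hy => hy; congr InvLim; exact: Prop_irrelevance.
Qed.

HB.instance Definition _ := gen_eqMixin invlim.
HB.instance Definition _ := gen_choiceMixin invlim.

Fact compatible0 : compatible (fun=> 0).
Proof. by move=> r s sr; rewrite rmorph0. Qed.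
Fact compatible1 : compatible (fun=> 1).
Proof. by move=> r s sr; rewrite rmorph1. Qed.
Fact compatibleN (x : invlim) : compatible (fun r => - x r).
Proof. by move=> r s sr; rewrite rmorphN; congr (- _); exact: invlim_compat. Qed.
Fact compatibleD (x y : invlim) : compatible (fun r => x r + y r).
Proof. by move=> r s sr; rewrite rmorphD; congr (_ + _); exact: invlim_compat. Qed.
Fact compatibleM (x y : invlim) : compatible (fun r => x r * y r).
Proof. by move=> r s sr; rewrite rmorphM; congr (_ * _); exact: invlim_compat. Qed.
Fact compatibleZ (c : K) (x : invlim) : compatible (fun r => c *: x r).
Proof. by move=> r s sr; rewrite linearZZ; congr (_ *: _); exact: invlim_compat. Qed.

Definition invlim_zero := InvLim compatible0.
Definition invlim_one := InvLim compatible1.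
Definition invlim_opp (x : invlim) := InvLim (compatibleN x).
Definition invlim_add (x y : invlim) := InvLim (compatibleD x y).
Definition invlim_mul (x y : invlim) := InvLim (compatibleM x y).
Definition invlim_scale (c : K) (x : invlim) := InvLim (compatibleZ c x).

Fact invlim_addA : associative invlim_add.
Proof. by move=> x y z; apply: invlimP => r; exact: addrA. Qed.
Fact invlim_addC : commutative invlim_add.
Proof. by move=> x y; apply: invlimP => r; exact: addrC. Qed.
Fact invlim_add0 : left_id invlim_zero invlim_add.
Proof. by move=> x; apply: invlimP => r; exact: add0r. Qed.
Fact invlim_addN : left_inverse invlim_zero invlim_opp invlim_add.
Proof. by move=> x; apply: invlimP => r; exact: addNr. Qed.
HB.instance Definition _ := GRing.isZmodule.Build invlim
  invlim_addA invlim_addC invlim_add0 invlim_addN.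

Fact invlim_mulA : associative invlim_mul.
Proof. by move=> x y z; apply: invlimP => r; exact: mulrA. Qed.
Fact invlim_mul1 : left_id invlim_one invlim_mul.
Proof. by move=> x; apply: invlimP => r; exact: mul1r. Qed.
Fact invlim_1mul : right_id invlim_one invlim_mul.
Proof. by move=> x; apply: invlimP => r; exact: mulr1. Qed.
Fact invlim_mulDl : left_distributive invlim_mul +%R.
Proof. by move=> x y z; apply: invlimP => r; exact: mulrDl. Qed.
Fact invlim_mulDr : right_distributive invlim_mul +%R.
Proof. by move=> x y z; apply: invlimP => r; exact: mulrDr. Qed.
Fact invlim_1neq0 : invlim_one != 0.
Proof.
apply/eqP => /(congr1 (fun x : invlim => x 0%N)) /= /eqP.
by rewrite oner_eq0.
Qed.
HB.instance Definition _ := GRing.Zmodule_isNzRing.Build invlim invlim_mulA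
  invlim_mul1 invlim_1mul invlim_mulDl invlim_mulDr invlim_1neq0.

Fact invlim_scaleA a b x :
  invlim_scale a (invlim_scale b x) = invlim_scale (a * b) x.
Proof. by apply: invlimP => r; exact: scalerA. Qed.
Fact invlim_scale1 : left_id 1 invlim_scale.
Proof. by move=> x; apply: invlimP => r; exact: scale1r. Qed.
Fact invlim_scaleDr : right_distributive invlim_scale +%R.
Proof. by move=> c x y; apply: invlimP => r; exact: scalerDr. Qed.
Fact invlim_scaleDl x : {morph invlim_scale^~ x : a b / a + b}.
Proof. by move=> a b; apply: invlimP => r; exact: scalerDl. Qed.
HB.instance Definition _ := GRing.Zmodule_isLmodule.Build K invlim
  invlim_scaleA invlim_scale1 invlim_scaleDr invlim_scaleDl.

Fact invlim_scaleAl (c : K) (x y : invlim) : c *: (x * y) = (c *: x) * y.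
Proof. by apply: invlimP => r; exact: scalerAl. Qed.
HB.instance Definition _ := GRing.Lmodule_isLalgebra.Build K invlim invlim_scaleAl.
Fact invlim_scaleAr (c : K) (x y : invlim) : c *: (x * y) = x * (c *: y).
Proof. by apply: invlimP => r; exact: scalerAr. Qed.
HB.instance Definition _ := GRing.Lalgebra_isAlgebra.Build K invlim invlim_scaleAr.

(* Inverses are obtained by choice; a non-invertible element is its own
   inverse, as everywhere in MathComp. *)
Definition invlim_inverse (x y : invlim) : Prop := y * x = 1 /\ x * y = 1.
Definition invlim_unit (x : invlim) : bool := `[< exists y, invlim_inverse x y >].
Definition invlim_inv (x : invlim) : invlim :=
  if pselect (exists y, invlim_inverse x y) is left h then sval (cid h) else x.

Fact invlim_mulVx : {in invlim_unit, left_inverse 1 invlim_inv *%R}.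
Proof.
move=> x /asboolP h; rewrite /invlim_inv; case: pselect => // h'.
by case: cid => y [].
Qed.
Fact invlim_mulxV : {in invlim_unit, right_inverse 1 invlim_inv *%R}.
Proof.
move=> x /asboolP h; rewrite /invlim_inv; case: pselect => // h'.
by case: cid => y [].
Qed.
Fact invlim_unitP (x y : invlim) : invlim_inverse x y -> invlim_unit x.
Proof. by move=> h; apply/asboolP; exists y. Qed.
Fact invlim_inv_out : {in [predC invlim_unit], invlim_inv =1 id}.
Proof.
move=> x; rewrite inE /= => /asboolPn h; rewrite /invlim_inv.
by case: pselect => // h'; case: h.
Qed.
HB.instance Definition _ := GRing.NzRing_hasMulInverse.Build invlim
  invlim_mulVx invlim_mulxV invlim_unitP invlim_inv_out.

Lemma invlim1E r : (1 : invlim) r = 1. Proof. by []. Qed.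
Lemma invlimDE (x y : invlim) r : (x + y) r = x r + y r. Proof. by []. Qed.
Lemma invlimME (x y : invlim) r : (x * y) r = x r * y r. Proof. by []. Qed.
Lemma invlimZE c (x : invlim) r : (c *: x) r = c *: x r. Proof. by []. Qed.

End InverseLimit.

Arguments yh_g {K} u d {n} i.
Arguments yh_h {K} u d {n} i.

(* C[z, x_1, ..., x_{d-1}]: the variable of index 0 is z and the variable of
   index m, 0 < m < d, is x_m. *)
Notation trace_ring K d := {mpoly K[d.-1.+1]}.

Section TraceRing.
Variable K : numFieldType.

Definition tr_z (d : nat) : trace_ring K d := 'X_ord0.

(* x_m for every integer m: depends on m modulo d only, and x_0 = 1. *)
Definition tr_x (d : nat) (m : int) : trace_ring K d :=
  let j := `|(m %% d)%Z|%N in if j == 0%N then 1 else 'X_(inord j).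

Definition tr_proj (d d' : nat) : {lrmorphism trace_ring K d -> trace_ring K d'} :=
  comp_mpoly [tuple if i == ord0 then tr_z d' else tr_x d' i | i < d.-1.+1].

Lemma tr_proj_z d d' : tr_proj d d' (tr_z d) = tr_z d'.
Proof. by rewrite /= comp_mpolyXU -tnth_nth tnth_mktuple. Qed.

Lemma tr_proj_x d d' m : (0 < d)%N -> (d' %| d)%N ->
  tr_proj d d' (tr_x d m) = tr_x d' m.
Proof.
move=> d_gt0 d'd; have d'_gt0 := dvdn_gt0 d_gt0 d'd.
have dz : (d : int) != 0 by rewrite -lt0n.
have jd : (`|(m %% d)%Z| < d)%N.
  by rewrite -ltz_nat gez0_abs ?modz_ge0 // ltz_pmod.
have mE : m = ((m %/ d)%Z * d + `|(m %% d)%Z|%N)%R :> int.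
  by rewrite gez0_abs ?modz_ge0 // -divz_eq.
have xm : tr_x d' m = tr_x d' `|(m %% d)%Z|%N.
  have e : (m %% d' = `|(m %% d)%Z|%N %% d')%Z.
    rewrite {1}mE -{2}(divnK d'd) PoszM mulrA; exact: modzMDl.
  by rewrite /tr_x e.
rewrite xm {1}/tr_x; case: eqP => [->|/eqP j0].
  by rewrite rmorph1 /tr_x mod0z.
rewrite /= comp_mpolyXU -tnth_nth tnth_mktuple.
by rewrite -val_eqE /= !inordK ?prednK // (negbTE j0).
Qed.

End TraceRing.

(* The index of the last generator g_n of the algebra of rank n + 1. *)
Definition last_gen (n : nat) (n_gt0 : (0 < n)%N) : 'I_n :=
  Ordinal (etrans (ltn_predL n) n_gt0).

(* A linear map on the union of the tower (yh u d n)_n is a family of linear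
   maps compatible with the inclusions. *)
Record markov_trace (K : numFieldType) (u : K) (d : nat)
    (tr : forall n, {linear yh u d n -> trace_ring K d}) : Prop := MarkovTrace {
  mt_incl n (a : yh u d n) : tr n.+1 (yh_incl a) = tr n a;
  mt_mulC n (a b : yh u d n) : tr n (a * b) = tr n (b * a);
  mt_one n : tr n 1 = 1;
  mt_g n (n_gt0 : (0 < n)%N) (a b : yh u d n) :
    tr n.+1 (yh_incl a * yh_g u d (last_gen n_gt0 : 'I_(n.+1).-1) * yh_incl b) =
    tr_z K d * tr n (a * b);
  mt_h n (a b : yh u d n) (m : nat) : (0 < m < d)%N ->
    tr n.+1 (yh_incl a * yh_h u d (ord_max : 'I_n.+1) ^+ m * yh_incl b) =
    tr_x K d m * tr n (a * b)
}.

Section Padic.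
Variables (K : numFieldType) (p : nat) (p_prime : prime p).

(* Sequences indexed by r >= 1 are shifted: position r carries level r + 1. *)
Fact level_gt0 r : (0 < p ^ r.+1)%N.
Proof. by rewrite expn_gt0 prime_gt0. Qed.
Fact level_dvd r s : (s <= r)%N -> (p ^ s.+1 %| p ^ r.+1)%N.
Proof. by move=> sr; rewrite dvdn_exp2l. Qed.

Definition trace_lim :=
  @invlim K (fun r => trace_ring K (p ^ r.+1))
    (fun r s _ => tr_proj K (p ^ r.+1) (p ^ s.+1)).
HB.instance Definition _ := GRing.UnitAlgebra.on trace_lim.

Fact lim_z_compat r s : (s <= r)%N ->
  tr_proj K (p ^ r.+1) (p ^ s.+1) (tr_z K (p ^ r.+1)) = tr_z K (p ^ s.+1).
Proof. by move=> _; exact: tr_proj_z. Qed.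
Definition lim_z : trace_lim := InvLim lim_z_compat.

Fact lim_x_compat m r s : (s <= r)%N ->
  tr_proj K (p ^ r.+1) (p ^ s.+1) (tr_x K (p ^ r.+1) m) = tr_x K (p ^ s.+1) m.
Proof. by move=> sr; rewrite tr_proj_x ?level_gt0 // level_dvd. Qed.
Definition lim_x (m : int) : trace_lim := InvLim (lim_x_compat m).

Variable u : K.

Definition level_proj n r s (sr : (s <= r)%N) :
    {lrmorphism yh u (p ^ r.+1) n -> yh u (p ^ s.+1) n} :=
  @yh_proj K u (p ^ r.+1) (p ^ s.+1) n (level_gt0 r) (level_dvd sr).

Definition yh_lim n := @invlim K (fun r => yh u (p ^ r.+1) n) (level_proj n).
HB.instance Definition _ n := GRing.UnitAlgebra.on (yh_lim n).

Section Generators.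
Variable n : nat.

Fact lim_g_compat (i : 'I_n.-1) r s (sr : (s <= r)%N) :
  level_proj n sr (yh_g u (p ^ r.+1) i) = yh_g u (p ^ s.+1) i.
Proof. by rewrite /= yh_proj_of framed_mod_sigma. Qed.
Definition lim_g (i : 'I_n.-1) : yh_lim n := InvLim (lim_g_compat i).

Fact lim_t_compat (i : 'I_n) r s (sr : (s <= r)%N) :
  level_proj n sr (yh_h u (p ^ r.+1) i) = yh_h u (p ^ s.+1) i.
Proof. by rewrite /= yh_proj_of framed_mod_frame. Qed.
Definition lim_t (i : 'I_n) : yh_lim n := InvLim (lim_t_compat i).

Fact lim_tV_compat (i : 'I_n) r s (sr : (s <= r)%N) :
  level_proj n sr (yh_of u (frame_gen (p ^ r.+1) i)^-1%g) =
  yh_of u (frame_gen (p ^ s.+1) i)^-1%g.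
Proof. by rewrite /= yh_proj_of gmulfV /= framed_mod_frame. Qed.

Lemma lim_t_unit i : lim_t i \is a GRing.unit.
Proof.
apply/unitrP; exists (InvLim (lim_tV_compat i)); split; apply: invlimP => r.
  by rewrite invlimME /= -yh_ofM mulVg.
by rewrite invlimME /= -yh_ofM mulgV.
Qed.

Fact lim_incl_compat (x : yh_lim n) r s (sr : (s <= r)%N) :
  level_proj n.+1 sr (yh_incl (x r)) = yh_incl (x s).
Proof. by rewrite -(invlim_compat x sr); exact: yh_proj_incl. Qed.
Definition lim_incl (x : yh_lim n) : yh_lim n.+1 := InvLim (lim_incl_compat x).

End Generators.
End Padic.

(* Main.v *)
From HB Require Import structures.
Require Import Defs.
From mathcomp Require Import mpoly monalg.
From mathcomp Require Import all_boot all_order all_fingroup all_algebra.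
From mathcomp Require Import boolp reals complex.

(** A family of maps between the levels of two inverse systems induces a map of
    the limits exactly when it commutes with the transition maps.  Once the
    traces tau_r are known to do so, every identity claimed for the limit trace
    is checked level by level, where it is one of the defining properties of
    tau_r; the limit trace itself is forced by its components.

    Compatibility ([markov_trace_proj]) means that delta o tau_r = tau_s o phi,
    where phi and delta are the transition maps on the algebras and on the
    polynomial rings.  Since phi sends h_i to h_i and g_i to g_i, and delta
    sends z to z and x_m to x_m, both sides satisfy the same recursion: they
    send a h_(n+1)^m b to x_m f(a b) and a g_n b to z f(a b), for a and b of
    rank n.  So the claim is the uniqueness half of Juyumaya's theorem.

    Uniqueness holds because the algebra of rank n + 1 is spanned linearly by
    the elements a h_(n+1)^m b and a g_n b with a, b of rank n
    ([markov_span_all]).  One proves that this span is stable under left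
    multiplication by a set of generators.  Everything is immediate from the
    commutation rules except g_n (a g_n b); there the spanning property of rank
    n rewrites a, and either the quadratic relation (when a = a' h_n^m b') or
    the braid relation (when a = a' g_(n-1) b') brings the product back to the
    span.  Stability under the inverse of g_n follows from the quadratic
    relation: it allows to solve for the inverse because its coefficient e_n is
    idempotent and u is invertible.

    The spanning argument is carried out for an arbitrary tower of algebras
    satisfying the relations, then specialised to the Yokonuma-Hecke tower. *)

Set Implicit Arguments.
Unset Strict Implicit.
Unset Printing Implicit Defensive.

Import GRing.Theory Num.Theory.
Local Open Scope quotient_scope.
Local Open Scope ring_scope.

Definition lin_closed (K : nzRingType) (V : lmodType K) (P : V -> Prop) :=
  forall (c : K) x y, P x -> P y -> P (c *: x + y).

(** * The span of a tower with the Yokonuma-Hecke relations *)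

Lemma sum_period_shift (V : zmodType) d (F : nat -> V) k :
  (forall m, F (d + m)%N = F m) ->
  \sum_(1 <= m < d.+1) F (k + m)%N = \sum_(1 <= m < d.+1) F m.
Proof.
move=> Fd; elim: k => [//|k <-]; apply/eqP; rewrite -subr_eq0 -sumrB.
under eq_bigr => m _ do rewrite addSnnS.
rewrite (telescope_sumr (fun m => F (k + m)%N)) // -[d.+1]addn1 addnCA Fd.
by rewrite subrr.
Qed.

Section Tower.
Variables (K : numFieldType) (u : K) (d : nat).
Hypotheses (u_neq0 : u != 0) (d_gt0 : (0 < d)%N).

Variable Y : nat -> algType K.
Variable inc : forall n, {lrmorphism Y n -> Y n.+1}.
Variable h : forall n, Y n.+1.
Variables g gV : forall n, Y n.+2.

(** The exponent d - m stands for - m, so that no inverse of [h] is mentioned: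
    this is the idempotent e_n of the quadratic relation. *)
Definition tower_e n : Y n.+2 :=
  d%:R^-1 *: \sum_(1 <= m < d.+1) inc n.+1 (h n) ^+ m * h n.+1 ^+ (d - m).

Hypothesis h_ord : forall n, h n ^+ d = 1.
Hypothesis inc_h : forall n (a : Y n) m, inc n a * h n ^+ m = h n ^+ m * inc n a.
Hypothesis inc_g :
  forall n (a : Y n), inc n.+1 (inc n a) * g n = g n * inc n.+1 (inc n a).
Hypothesis g_h : forall n m, g n * h n.+1 ^+ m = inc n.+1 (h n) ^+ m * g n.
Hypothesis g_inc_h : forall n m, g n * inc n.+1 (h n) ^+ m = h n.+1 ^+ m * g n.
Hypothesis g_braid : forall n,
  g n.+1 * inc n.+2 (g n) * g n.+1 = inc n.+2 (g n) * g n.+1 * inc n.+2 (g n).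
Hypothesis g_quad : forall n,
  g n * g n = 1 + (u - 1) *: (tower_e n * (1 - g n)).
Hypothesis g_gV : forall n, g n * gV n = 1.
(* Generation is phrased as an induction on left multiplication by generators,
   the form in which the stability of the span is used. *)
Hypothesis gen_0 : forall x : Y 0, exists c : K, x = c *: 1.
Hypothesis gen_1 : forall P : Y 1 -> Prop, lin_closed P -> P 1 ->
  (forall a x, P x -> P (inc 0 a * x)) ->
  (forall m x, P x -> P (h 0 ^+ m * x)) -> forall x, P x.
Hypothesis gen_S : forall n (P : Y n.+2 -> Prop), lin_closed P -> P 1 ->
  (forall a x, P x -> P (inc n.+1 a * x)) ->
  (forall m x, P x -> P (h n.+1 ^+ m * x)) ->
  (forall x, P x -> P (g n * x)) -> (forall x, P x -> P (gV n * x)) ->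
  forall x, P x.

(** The average of the powers of an element t with t^d = 1 is fixed by
    multiplication by t, hence idempotent. *)
Lemma tower_e_idem n : tower_e n * tower_e n = tower_e n.
Proof.
pose x := inc n.+1 (h n); pose y := h n.+1 ^+ d.-1; pose t := x * y.
have xd : x ^+ d = 1 by rewrite /x -rmorphXn h_ord rmorph1.
have yd : y ^+ d = 1 by rewrite /y exprAC h_ord expr1n.
have xy : GRing.comm x y by exact: inc_h.
have td : t ^+ d = 1 by rewrite /t exprMn_comm // xd yd mulr1.
have eE : tower_e n = d%:R^-1 *: \sum_(1 <= m < d.+1) t ^+ m.
  congr (_ *: _); apply: eq_big_nat => m /andP[m_gt0 m_le].
  rewrite /t exprMn_comm //; congr (_ * _).
  have yhm : y ^+ m * h n.+1 ^+ m = 1.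
    by rewrite -exprMn_comm /y -?exprSr ?prednK // ?h_ord ?expr1n //; exact/commr_sym/commrX.
  by rewrite -[LHS]mul1r -yhm -mulrA -exprD subnKC // h_ord mulr1.
have te k : t ^+ k * tower_e n = tower_e n.
  rewrite eE -scalerAr mulr_sumr; congr (_ *: _).
  under eq_bigr => m _ do rewrite -exprD.
  by apply: (sum_period_shift (F := fun m => t ^+ m)) => m; rewrite exprD td mul1r.
rewrite {1}eE -scalerAl mulr_suml.
under eq_bigr => m _ do rewrite te.
rewrite sumr_const_nat subSS subn0 -scaler_nat scalerA mulVf ?scale1r //.
by rewrite pnatr_eq0 -lt0n.
Qed.

(** In rank 1 there is no generator g, whence the case distinction. *)
Definition is_gterm n : Y n.+1 -> Prop :=
  match n return Y n.+1 -> Prop with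
  | 0 => fun _ => False
  | k.+1 => fun x => exists a b, x = inc k.+1 a * g k * inc k.+1 b
  end.

Inductive markov_span n : Y n.+1 -> Prop :=
| span_lin c x y : markov_span x -> markov_span y -> markov_span (c *: x + y)
| span_h a m b : markov_span (inc n a * h n ^+ m * inc n b)
| span_g x : is_gterm x -> markov_span x.

Lemma span_inc n (a : Y n) : markov_span (inc n a).
Proof. by have := span_h a 0 1; rewrite rmorph1 expr0 !mulr1. Qed.

Lemma span1 n : markov_span (1 : Y n.+1).
Proof. by rewrite -(rmorph1 (inc n)); exact: span_inc. Qed.

Lemma span0 n : markov_span (0 : Y n.+1).
Proof. by rewrite -(addNr 1) -scaleN1r; apply: span_lin; exact: span1. Qed.

Lemma spanD n (x y : Y n.+1) : markov_span x -> markov_span y -> markov_span (x + y).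
Proof. by move=> Sx Sy; rewrite -[x]scale1r; exact: span_lin. Qed.

Lemma spanZ n c (x : Y n.+1) : markov_span x -> markov_span (c *: x).
Proof. by move=> Sx; rewrite -[_ *: _]addr0; apply: span_lin => //; exact: span0. Qed.

Lemma spanB n (x y : Y n.+1) : markov_span x -> markov_span y -> markov_span (x - y).
Proof. by move=> Sx Sy; rewrite addrC -scaleN1r; exact: span_lin. Qed.

Lemma span_incl_mull n a (x : Y n.+1) : markov_span x -> markov_span (inc n a * x).
Proof.
elim=> {x} [c x y _ Sx _ Sy|b m c|x].
- by rewrite mulrDr -scalerAr; exact: span_lin.
- by rewrite !mulrA -rmorphM; exact: span_h.
- case: n a x => [//|k] a x [b [c ->]]; apply: span_g.
  by exists (a * b), c; rewrite !mulrA rmorphM.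
Qed.

Lemma span_h_mull n m (x : Y n.+1) : markov_span x -> markov_span (h n ^+ m * x).
Proof.
elim=> {x} [c x y _ Sx _ Sy|b k c|x].
- by rewrite mulrDr -scalerAr; exact: span_lin.
- by rewrite !mulrA -inc_h -[_ * _ * h n ^+ k]mulrA -exprD; exact: span_h.
- case: n x => [//|n] x [b [c ->]]; apply: span_g.
  exists b, (h n ^+ m * c).
  by rewrite rmorphM rmorphXn /= !mulrA -inc_h -!mulrA (mulrA (g n)) g_inc_h !mulrA.
Qed.

Lemma span_e_mull n (x : Y n.+2) : markov_span x -> markov_span (tower_e n * x).
Proof.
move=> Sx; rewrite -scalerAl mulr_suml; apply: spanZ.
apply: (big_ind (@markov_span n.+1)) => [|y z|m _]; [exact: span0|exact: spanD|].
by rewrite -mulrA -rmorphXn; apply: span_incl_mull; exact: span_h_mull.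
Qed.

Lemma span_g_inc n b : markov_span (g n * inc n.+1 b).
Proof. by apply: span_g; exists 1, b; rewrite rmorph1 mul1r. Qed.

Lemma span_gg_inc n b : markov_span (g n * g n * inc n.+1 b).
Proof.
rewrite g_quad mulrDl mul1r -scalerAl -mulrA mulrBl mul1r.
apply: spanD; first exact: span_inc.
by apply/spanZ/span_e_mull/spanB; [exact: span_inc | exact: span_g_inc].
Qed.

(** The only place where the spanning property of the previous rank enters:
    it gives the form of the element caught between two copies of g. *)
Lemma span_g_mull n : (forall a : Y n.+1, markov_span a) ->
  forall x : Y n.+2, markov_span x -> markov_span (g n * x).
Proof.
move=> span_n x; elim=> {x} [c x y _ Sx _ Sy|a m b|_ [a [b ->]]].
- by rewrite mulrDr -scalerAr; exact: span_lin.
- rewrite inc_h -mulrA -rmorphM mulrA g_h -mulrA -rmorphXn.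
  by apply: span_incl_mull; exact: span_g_inc.
rewrite !mulrA; move: b; elim: {a}(span_n a) => [c y y' _ Sy _ Sy'|a m c|y gy] b.
- rewrite linearP mulrDr -scalerAr !mulrDl -!scalerAl.
  exact: span_lin.
(* The power of h crosses g and the quadratic relation applies to g * g. *)
- have -> : g n * inc n.+1 (inc n a * h n ^+ m * inc n c) * g n * inc n.+1 b =
      inc n.+1 (inc n a) * (h n.+1 ^+ m * (g n * g n * inc n.+1 (inc n c * b))).
    rewrite !rmorphM rmorphXn /= !mulrA -inc_g -!(mulrA (inc n.+1 (inc n a))).
    congr (_ * _); rewrite g_inc_h -!mulrA; do 2!congr (_ * _).
    by rewrite !mulrA inc_g.
  by apply/span_incl_mull/span_h_mull/span_gg_inc.
case: n span_n y gy b => [//|n] span_n y [a [c ->]] b.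
(* The braid relation leaves a single occurrence of the last generator. *)
have -> : g n.+1 * inc n.+2 (inc n.+1 a * g n * inc n.+1 c) * g n.+1 * inc n.+2 b =
    inc n.+2 (inc n.+1 a * g n) * g n.+1 * inc n.+2 (g n * inc n.+1 c * b).
  rewrite !rmorphM /= !mulrA -inc_g -!(mulrA (inc n.+2 (inc n.+1 a))).
  congr (_ * _); rewrite -!(mulrA _ _ (g n.+1)) inc_g !mulrA g_braid.
  by rewrite -!mulrA.
by apply: span_g; eexists; eexists.
Qed.

(** Multiplying the quadratic relation by the inverse of g on the right gives
    an equation for gV in terms of g, e and e gV; multiplying once more by the
    idempotent e gives an equation for e gV alone, solvable as u is nonzero. *)
Lemma span_gV_mull n : (forall x : Y n.+2, markov_span x -> markov_span (g n * x)) ->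
  forall x : Y n.+2, markov_span x -> markov_span (gV n * x).
Proof.
move=> span_gx x Sx; pose e := tower_e n.
have gE : g n = gV n + (u - 1) *: (e * gV n - e).
  rewrite -[LHS]mulr1 -(g_gV n) mulrA g_quad mulrDl mul1r -scalerAl -mulrA.
  by rewrite mulrBl mul1r g_gV mulrBr mulr1.
have egE : e * gV n = u^-1 *: (e * g n + (u - 1) *: e).
  rewrite {1}gE mulrDr -scalerAr mulrBr mulrA tower_e_idem -/e scalerBr.
  rewrite addrA subrK -[X in X + _]scale1r -scalerDl addrC subrK.
  by rewrite scalerA mulVf // scale1r.
have -> : gV n = g n - (u - 1) *: (e * gV n - e) by rewrite {1}gE addrK.
rewrite mulrBl -scalerAl mulrBl egE -scalerAl mulrDl -(scalerAl (u - 1)) -(mulrA e).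
apply: spanB; first exact: span_gx.
apply/spanZ/spanB; last exact: span_e_mull.
apply/spanZ/spanD; first by apply/span_e_mull/span_gx.
by apply/spanZ/span_e_mull.
Qed.

Lemma markov_span_all n (x : Y n.+1) : markov_span x.
Proof.
elim: n x => [|n IHn].
  apply: gen_1; [exact: span_lin | exact: span1 | exact: span_incl_mull|].
  exact: span_h_mull.
have span_gx := @span_g_mull n IHn.
apply: gen_S => //; [exact: span_lin | exact: span1 | exact: span_incl_mull| |].
  exact: span_h_mull.
exact: span_gV_mull.
Qed.

Section Uniqueness.
Variables (V : algType K) (z : V) (x : nat -> V).

(** The recursion obeyed by every Markov trace.  Each of the last two clauses
    lowers the rank by one on one family of spanning elements. *)
Definition markov_rec (f : forall n, {linear Y n -> V}) :=
  [/\ f 0 1 = 1,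
      forall n a m b, f n.+1 (inc n a * h n ^+ m * inc n b) = x m * f n (a * b)
    & forall n a b, f n.+2 (inc n.+1 a * g n * inc n.+1 b) = z * f n.+1 (a * b)].

Lemma markov_rec_unique f f' :
  markov_rec f -> markov_rec f' -> forall n, f n =1 f' n.
Proof.
move=> [f1 fh fg] [f'1 f'h f'g]; elim=> [|n IHn] y.
  by have [c ->] := gen_0 y; rewrite !linearZ f1 f'1.
elim: {y}(markov_span_all y) => [c y1 y2 _ E1 _ E2|a m b|y gy].
- by rewrite !linearP E1 E2.
- by rewrite fh f'h IHn.
- case: n IHn y gy => [//|n] IHn y [a [b ->]].
  by rewrite fg f'g IHn.
Qed.

End Uniqueness.
End Tower.

(** * Relations between framed braids *)

Section FramedBraids.
Variables d n : nat.

Lemma sigma_frame (i : 'I_n.-1) (j : 'I_n) m :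
  (sigma_gen d i * frame_gen d j ^+ m =
   frame_gen d (strand_swap i j) ^+ m * sigma_gen d i)%g.
Proof.
rewrite !frame_genX; congr FramedBraid; last by rewrite /= mulg1 mul1g.
apply/ffunP=> k; rewrite !ffunE /= braid_perm_gen add0r addr0.
by rewrite (can2_eq (tpermK _ _) (tpermK _ _)).
Qed.

(** The frame of the last strand is split off; the rest is in the image of the
    smaller group. *)
Lemma frame_split (a : frame d n.+1) :
  FramedBraid a 1%g =
  (framed_incl (FramedBraid [ffun i => a (lift ord_max i)] 1%g) *
   frame_gen d ord_max ^+ a ord_max)%g.
Proof.
rewrite frame_genX; congr FramedBraid; last by rewrite /= gmulf1 mulg1.
apply/ffunP=> j; rewrite !ffunE /= !gmulf1 perm1.
case: unliftP => [i ->|->]; rewrite ?eqxx ?ffunE.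
  by rewrite eq_sym (negbTE (neq_lift _ _)) addr0.
by rewrite add0r valZpK.
Qed.

Lemma incl_frame_comm (x : framed_braid d n) m :
  (framed_incl x * frame_gen d ord_max ^+ m =
   frame_gen d ord_max ^+ m * framed_incl x)%g.
Proof.
rewrite frame_genX; case: x => a s.
congr FramedBraid; last by rewrite /= mul1g mulg1.
have [h1 h2] := braid_perm_incl s.
apply/ffunP=> j; rewrite !ffunE /= gmulf1 perm1 addrC.
case: unliftP => [i ->|->]; rewrite ?h1 ?h2 ?eqxx ?unlift_none ?addr0 //.
by rewrite ![lift _ _ == _]eq_sym !(negbTE (neq_lift _ _)).
Qed.

(** An element of rank n does not involve the last two strands of rank n + 2,
    the only ones that the last generator moves. *)
Lemma sigma_incl_comm (x : framed_braid d n) :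
  (framed_incl (framed_incl x) * sigma_gen d (ord_max : 'I_(n.+2).-1) =
   sigma_gen d (ord_max : 'I_(n.+2).-1) * framed_incl (framed_incl x))%g.
Proof.
case: x => a s; congr FramedBraid => /=.
  have e1 : strand (ord_max : 'I_(n.+2).-1) = lift ord_max ord_max.
    by apply: val_inj; rewrite /= /bump leqNgt ltnSn.
  have e2 : next_strand (ord_max : 'I_(n.+2).-1) = ord_max by apply: val_inj.
  apply/ffunP=> j; rewrite !ffunE /= braid_perm_gen add0r addr0 /strand_swap e1 e2.
  by case: tpermP => [->|->|//]; rewrite ?liftK !unlift_none ?ffunE unlift_none.
have gen (i : 'I_n.-1) : commute (braid_gen (ord_max : 'I_(n.+2).-1))
    (braid_incl (braid_incl (braid_gen i))).
  rewrite /commute !braid_incl_gen.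
  apply: etrans (esym _); last exact: presented_mulE.
  apply: etrans; first exact: presented_mulE.
  apply: presented_eq; apply: wc_sym; apply: wc_rel; apply: braid_far => /=.
  exact: next_strand_subproof.
pose P (x : braid n) := commute (braid_gen (ord_max : 'I_(n.+2).-1))
    (braid_incl (braid_incl x)).
have PM x y : P x -> P y -> P (x * y)%g.
  by move=> Px Py; rewrite /P !gmulfM; exact: commuteM.
have PV x : P x -> P x^-1%g by move=> Px; rewrite /P !gmulfV; exact: commuteV.
suff: P s by move/esym.
elim/presented_ind: s => [|i x|i x].
- by rewrite /P !gmulf1; exact: commute1.
- exact: PM (gen i).
- exact: PM (PV _ (gen i)).
Qed.

Lemma sigma_braid (i j : 'I_n.-1) : i.+1 = j :> nat ->
  (sigma_gen d i * sigma_gen d j * sigma_gen d i =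
   sigma_gen d j * sigma_gen d i * sigma_gen d j)%g.
Proof.
move=> ij; congr FramedBraid => /=.
  by apply/ffunP=> k; rewrite !ffunE !addr0.
have prod3 (x y z : 'I_n.-1) : (braid_gen x * braid_gen y * braid_gen z)%g =
    \pi_(presented (@braid_rel n)) [:: (x, true); (y, true); (z, true)].
  by rewrite [X in (X * _)%g]presented_mulE; exact: presented_mulE.
by rewrite !prod3; apply: presented_eq; apply: wc_rel; exact: braid_near.
Qed.

End FramedBraids.

Lemma framed_ind d n (P : framed_braid d n -> Prop) :
    P 1%g -> (forall a x, P x -> P (FramedBraid a 1 * x)%g) ->
    (forall i x, P x -> P (sigma_gen d i * x)%g) ->
    (forall i x, P x -> P ((sigma_gen d i)^-1 * x)%g) ->
  forall x, P x.
Proof.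
move=> P1 Pa Pg PV [a s].
have -> : FramedBraid a s = (FramedBraid a 1 * FramedBraid 0 s)%g.
  congr FramedBraid; last by rewrite /= mul1g.
  by apply/ffunP=> j; rewrite !ffunE addr0.
apply: Pa; elim/presented_ind: s => [|i s|i s]; first exact: P1.
  move/(Pg i); congr P; congr FramedBraid.
  by apply/ffunP=> j; rewrite !ffunE add0r.
move/(PV i); congr P; congr FramedBraid.
by apply/ffunP=> j; rewrite !ffunE oppr0 add0r.
Qed.

(** With no strand there is nothing to frame and nothing to braid. *)
Lemma framed_braid0 d (x : framed_braid d 0) : x = 1%g.
Proof.
elim/framed_ind: x => [//|a x ->|[]//|[]//].
by rewrite mulg1; congr FramedBraid; apply/ffunP=> -[].
Qed.

Lemma last_or_strand n (i : 'I_(n.+1).-1) :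
  (exists j : 'I_n.-1, i = strand j) \/ (exists n_gt0 : (0 < n)%N, i = last_gen n_gt0).
Proof.
have n_gt0 : (0 < n)%N by case: n i => [[]|].
have: (i <= n.-1)%N by rewrite -ltnS prednK //; exact: ltn_ord i.
rewrite leq_eqVlt; case/orP => [/eqP e|lt].
  by right; exists n_gt0; exact: val_inj.
by left; exists (Ordinal lt); exact: val_inj.
Qed.

Lemma frame_gen_ord d n (i : 'I_n) : (0 < d)%N -> (frame_gen d i ^+ d = 1)%g.
Proof.
move=> d_gt0; rewrite frame_genX; congr FramedBraid; apply/ffunP=> j.
rewrite !ffunE; case: eqP => // _.
by apply: val_inj; rewrite /= prednK // modnn.
Qed.

(** * The tower of Yokonuma-Hecke algebras *)

(** Exposes an element of the group algebra as a finite linear combination of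
    group elements, once [galg_lift] is unfolded. *)
Lemma galgE (K : comNzRingType) (G : groupType) (x : galg K G) :
  x = galg_lift (@galg_of K G) x.
Proof.
move: x; apply: (@galg_ext K G _ id (galg_lift (@galg_of K G))) => [//|a x y|g].
  by rewrite linearP.
by rewrite galg_liftU.
Qed.

Lemma idealq_quad (K : comNzRingType) (A : algType K) (S : A -> Prop) c s e :
  S (s ^+ 2 - 1 - c *: (e * (1 - s))) ->
  idealq_pi S s * idealq_pi S s =
  1 + c *: (idealq_pi S e * (1 - idealq_pi S s)).
Proof.
have piN x : idealq_pi S (- x) = - idealq_pi S x.
  by rewrite -scaleN1r idealq_piZ scaleN1r.
move=> Ss; apply/eqP; rewrite -subr_eq0 opprD addrA; apply/eqP.
have <- : idealq_pi S (s ^+ 2 - 1 - c *: (e * (1 - s))) =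
    idealq_pi S s * idealq_pi S s - 1 -
    c *: (idealq_pi S e * (1 - idealq_pi S s)).
  rewrite expr2 idealq_piD piN idealq_piZ idealq_piM 2!idealq_piD !piN.
  by rewrite idealq_piM.
by rewrite -idealq_pi0; apply: idealq_eq; rewrite subr0; exact: ideal_gen_sub.
Qed.

Section Algebra.
Variables (K : numFieldType) (u : K) (d : nat).

Lemma yh_ind n (P : yh u d n -> Prop) :
  lin_closed P -> (forall g, P (yh_of u g)) -> forall x, P x.
Proof.
move=> Plin Pg; elim/idealqW => x.
have P0 : P 0 by rewrite -(addNr (yh_of u 1%g)) -scaleN1r; exact: Plin.
rewrite (galgE x) /galg_lift; elim/big_rec: _ => [//|g y _ Py].
by rewrite idealq_piD idealq_piZ; apply: Plin => //; exact: Pg.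
Qed.

Lemma yh0_scalar (x : yh u d 0) : exists c : K, x = c *: 1.
Proof.
elim/yh_ind: x => [c x y [a ->] [b ->]|g].
  by exists (c * a + b); rewrite scalerDl scalerA.
by exists 1; rewrite (framed_braid0 g) yh_of1 scale1r.
Qed.

(** Commutation and braid relations are identities between two products in the
    framed braid group, which is all that has to be transported. *)
Lemma yh_ofM_eq n (x y z t : framed_braid d n) : (x * y = z * t)%g ->
  yh_of u x * yh_of u y = yh_of u z * yh_of u t.
Proof. by move=> e; rewrite -[LHS]yh_ofM -[RHS]yh_ofM e. Qed.

Lemma yh_ofX n (x : framed_braid d n) m : yh_of u (x ^+ m)%g = yh_of u x ^+ m.
Proof. by elim: m => [//|m IH]; rewrite expgS exprS yh_ofM IH. Qed.

Lemma yh_hX n (i : 'I_n) m : yh_h u d i ^+ m = yh_of u (frame_gen d i ^+ m)%g.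
Proof. by rewrite yh_ofX. Qed.

(** A framed braid is a word in the frames, the sigma's and their inverses; all
    of these but the frame of the last strand and the last sigma come from the
    rank below. *)
Lemma yh_generated n (P : yh u d n.+1 -> Prop) :
    lin_closed P -> P 1 ->
    (forall a x, P x -> P (yh_incl a * x)) ->
    (forall m x, P x -> P (yh_h u d (ord_max : 'I_n.+1) ^+ m * x)) ->
    (forall (n_gt0 : (0 < n)%N) x, P x ->
      P (yh_g u d (last_gen n_gt0 : 'I_(n.+1).-1) * x) /\
      P (yh_of u (sigma_gen d (last_gen n_gt0 : 'I_(n.+1).-1))^-1%g * x)) ->
  forall x, P x.
Proof.
move=> Plin P1 Pi Ph Pg; apply: yh_ind => [c x y|x]; first exact: Plin.
have Pof (a : framed_braid d n.+1) z :
    P (yh_of u a * yh_of u z) -> P (yh_of u (a * z)%g) by rewrite yh_ofM.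
elim/framed_ind: x => [|a x Px|i x Px|i x Px]; first by rewrite yh_of1.
- rewrite frame_split -mulgA; apply: (Pof).
  rewrite -yh_incl_of; apply: Pi; apply: (Pof).
  by rewrite -yh_hX; exact: Ph.
- apply: (Pof); have [[j ->]|[n_gt0 ->]] := last_or_strand i; last first.
    exact: (Pg n_gt0 _ Px).1.
  by rewrite -framed_incl_sigma -yh_incl_of; exact: Pi.
- apply: (Pof); have [[j ->]|[n_gt0 ->]] := last_or_strand i; last first.
    exact: (Pg n_gt0 _ Px).2.
  by rewrite -framed_incl_sigma -gmulfV -yh_incl_of; exact: Pi.
Qed.

Lemma yh_hd n (i : 'I_n) : (0 < d)%N -> yh_h u d i ^+ d = 1.
Proof. by move=> d_gt0; rewrite yh_hX frame_gen_ord // yh_of1. Qed.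

Lemma incl_h_comm n (y : yh u d n) m :
  yh_incl y * yh_h u d (ord_max : 'I_n.+1) ^+ m =
  yh_h u d (ord_max : 'I_n.+1) ^+ m * yh_incl y.
Proof.
move: y; apply: yh_ext => [c x y|c x y|x].
- by rewrite linearP mulrDl scalerAl.
- by rewrite linearP mulrDr scalerAr.
- by rewrite yh_incl_of yh_hX; apply: yh_ofM_eq; exact: incl_frame_comm.
Qed.

Lemma incl_g_comm n (y : yh u d n) :
  yh_incl (yh_incl y) * yh_g u d (ord_max : 'I_(n.+2).-1) =
  yh_g u d (ord_max : 'I_(n.+2).-1) * yh_incl (yh_incl y).
Proof.
move: y; apply: yh_ext => [c x y|c x y|x].
- by rewrite !linearP mulrDl scalerAl.
- by rewrite !linearP mulrDr scalerAr.
- by rewrite !yh_incl_of; apply: yh_ofM_eq; exact: sigma_incl_comm.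
Qed.

Lemma g_h_swap n (i : 'I_n.-1) (j : 'I_n) m :
  yh_g u d i * yh_h u d j ^+ m = yh_h u d (strand_swap i j) ^+ m * yh_g u d i.
Proof.
rewrite /yh_g [X in _ * X = _]yh_hX [X in _ = X * _]yh_hX.
by apply: yh_ofM_eq; exact: sigma_frame.
Qed.

Lemma yh_braid n (i j : 'I_n.-1) : i.+1 = j :> nat ->
  yh_g u d i * yh_g u d j * yh_g u d i = yh_g u d j * yh_g u d i * yh_g u d j.
Proof.
move=> ij; rewrite /yh_g -[X in X * _ = _]yh_ofM -[X in _ = X * _]yh_ofM.
by apply: yh_ofM_eq; exact: sigma_braid.
Qed.

Lemma yh_incl_h n (i : 'I_n) : yh_incl (yh_h u d i) = yh_h u d (lift ord_max i).
Proof. by rewrite /yh_h yh_incl_of framed_incl_frame. Qed.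

Lemma yh_incl_g n (i : 'I_n.-1) :
  yh_incl (yh_g u d i) = yh_g u d (strand i : 'I_(n.+1).-1).
Proof. by rewrite /yh_g yh_incl_of framed_incl_sigma. Qed.

(** The image of [frame_idem], written with nonnegative powers. *)
Definition yh_e n (i : 'I_n.-1) : yh u d n :=
  d%:R^-1 *: \sum_(1 <= m < d.+1)
    yh_h u d (strand i) ^+ m * yh_h u d (next_strand i) ^+ (d - m).

Lemma yh_eE n (i : 'I_n.-1) : (0 < d)%N ->
  idealq_pi (@yh_relators K u d n) (frame_idem K d i) = yh_e i.
Proof.
move=> d_gt0; rewrite idealq_piZ; congr (_ *: _).
rewrite (big_morph (idealq_pi _) (@idealq_piD _ _ _) (idealq_pi0 _)).
apply: eq_big_nat => m /andP[m_gt0 m_le].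
have -> : (frame_gen d (next_strand i) ^- m = frame_gen d (next_strand i) ^+ (d - m))%g.
  apply: (@mulgI _ (frame_gen d (next_strand i) ^+ m)%g).
  by rewrite mulgV -expgnDr subnKC -1?ltnS // frame_gen_ord.
rewrite [X in _ = X * _]yh_hX [X in _ = _ * X]yh_hX; exact: yh_ofM.
Qed.

Lemma yh_g2 n (i : 'I_n.-1) : (0 < d)%N ->
  yh_g u d i * yh_g u d i = 1 + (u - 1) *: (yh_e i * (1 - yh_g u d i)).
Proof.
move=> d_gt0; rewrite -yh_eE //; apply: idealq_quad.
by exists i.
Qed.

End Algebra.

Section Instance.
Variables (K : numFieldType) (u : K) (d : nat).
Hypotheses (u_neq0 : u != 0) (d_gt0 : (0 < d)%N).

Let Y n : algType K := yh u d n.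
Let inc n : {lrmorphism Y n -> Y n.+1} := @yh_incl K u d n.
Let h n : Y n.+1 := yh_h u d (ord_max : 'I_n.+1).
Let g n : Y n.+2 := yh_g u d (ord_max : 'I_(n.+2).-1).
Let gV n : Y n.+2 := yh_of u (sigma_gen d (ord_max : 'I_(n.+2).-1))^-1%g.

Lemma last_genE n (n_gt0 : (0 < n.+1)%N) : last_gen n_gt0 = ord_max.
Proof. exact: val_inj. Qed.

Lemma strand_max n : strand (ord_max : 'I_(n.+2).-1) = lift ord_max ord_max.
Proof. by apply: val_inj; rewrite /= /bump leqNgt ltnSn. Qed.

Lemma next_strand_max n : next_strand (ord_max : 'I_(n.+2).-1) = ord_max.
Proof. exact: val_inj. Qed.

Lemma yh_e_tower n : yh_e u d (ord_max : 'I_(n.+2).-1) = tower_e d inc h n.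
Proof.
by rewrite /yh_e strand_max next_strand_max -yh_incl_h.
Qed.

Lemma tower_h_ord n : h n ^+ d = 1.
Proof. exact: yh_hd. Qed.

Lemma tower_g_h n m : g n * h n.+1 ^+ m = inc n.+1 (h n) ^+ m * g n.
Proof.
have := g_h_swap u d (ord_max : 'I_(n.+2).-1) ord_max m.
by rewrite /strand_swap next_strand_max tpermR strand_max -yh_incl_h.
Qed.

Lemma tower_g_inc_h n m : g n * inc n.+1 (h n) ^+ m = h n.+1 ^+ m * g n.
Proof.
have := g_h_swap u d (ord_max : 'I_(n.+2).-1) (strand (ord_max : 'I_(n.+2).-1)) m.
by rewrite /strand_swap tpermL next_strand_max strand_max -yh_incl_h.
Qed.

Lemma tower_g_braid n :
  g n.+1 * inc n.+2 (g n) * g n.+1 = inc n.+2 (g n) * g n.+1 * inc n.+2 (g n).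
Proof.
rewrite /inc /g /= yh_incl_g; apply/esym; exact: yh_braid.
Qed.

Lemma tower_g_quad n :
  g n * g n = 1 + (u - 1) *: (tower_e d inc h n * (1 - g n)).
Proof. by rewrite -yh_e_tower; exact: yh_g2. Qed.

Lemma tower_g_gV n : g n * gV n = 1.
Proof. by rewrite /g /gV /yh_g -yh_ofM mulgV yh_of1. Qed.

Lemma tower_gen_1 (P : Y 1 -> Prop) : lin_closed P -> P 1 ->
  (forall a x, P x -> P (inc 0 a * x)) ->
  (forall m x, P x -> P (h 0 ^+ m * x)) -> forall x, P x.
Proof. by move=> Plin P1 Pi Ph; exact: yh_generated. Qed.

Lemma tower_gen_S n (P : Y n.+2 -> Prop) : lin_closed P -> P 1 ->
  (forall a x, P x -> P (inc n.+1 a * x)) ->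
  (forall m x, P x -> P (h n.+1 ^+ m * x)) ->
  (forall x, P x -> P (g n * x)) -> (forall x, P x -> P (gV n * x)) ->
  forall x, P x.
Proof.
move=> Plin P1 Pi Ph Pg PV; apply: yh_generated;
  [exact: Plin | exact: P1 | exact: Pi | exact: Ph |].
by move=> n_gt0 x Px; rewrite last_genE; split; [exact: Pg | exact: PV].
Qed.

(** Uniqueness of the Juyumaya trace, with values in any algebra. *)
Lemma yh_trace_unique (V : algType K) (z : V) (x : nat -> V)
    (f f' : forall n, {linear yh u d n -> V}) :
  markov_rec inc h g z x f -> markov_rec inc h g z x f' -> forall n, f n =1 f' n.
Proof.
apply: (@markov_rec_unique K u d u_neq0 d_gt0 Y inc h g gV).
- exact: tower_h_ord.
- exact: incl_h_comm.
- exact: incl_g_comm.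
- exact: tower_g_h.
- exact: tower_g_inc_h.
- exact: tower_g_braid.
- exact: tower_g_quad.
- exact: tower_g_gV.
- exact: yh0_scalar.
- exact: tower_gen_1.
- exact: tower_gen_S.
Qed.

End Instance.

(** * Compatibility of Markov traces with the projections *)

Section Compat.
Variables (K : numFieldType) (u : K).

Lemma tr_x_mod (d : nat) (m m' : int) : (m %% d = m' %% d)%Z -> tr_x K d m = tr_x K d m'.
Proof. by rewrite /tr_x => ->. Qed.

(** The defining property for 0 < m < d extends to all m, since h has order
    dividing d and x_0 = 1. *)
Lemma markov_hX d (tr : forall n, {linear yh u d n -> trace_ring K d}) :
  (0 < d)%N -> markov_trace tr -> forall n (a b : yh u d n) (m : nat),
  tr n.+1 (yh_incl a * yh_h u d (ord_max : 'I_n.+1) ^+ m * yh_incl b) =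
  tr_x K d m * tr n (a * b).
Proof.
move=> d_gt0 mt n a b m.
have -> : tr_x K d m = tr_x K d (m %% d)%N.
  by apply: tr_x_mod; rewrite -modz_nat modz_mod.
rewrite -(expr_mod m (yh_hd u ord_max d_gt0)).
have [->|m_gt0] := posnP (m %% d)%N; last by apply: (mt_h mt); rewrite m_gt0 ltn_pmod.
rewrite expr0 mulr1 -rmorphM (mt_incl mt).
by rewrite /tr_x mod0z mul1r.
Qed.

Lemma yh_proj_hX d d' n (d_gt0 : (0 < d)%N) (d'd : (d' %| d)%N) (i : 'I_n) m :
  yh_proj d_gt0 d'd (yh_h u d i ^+ m) = yh_h u d' i ^+ m.
Proof.
apply: etrans (rmorphXn (@yh_proj K u d d' n d_gt0 d'd) m _) _ => /=.
by rewrite /yh_h yh_proj_of framed_mod_frame.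
Qed.

Lemma yh_proj_g d d' n (d_gt0 : (0 < d)%N) (d'd : (d' %| d)%N) (i : 'I_n.-1) :
  yh_proj d_gt0 d'd (yh_g u d i) = yh_g u d' i.
Proof. by rewrite /yh_g yh_proj_of framed_mod_sigma. Qed.

Lemma yh_proj_sandwich d d' n (d_gt0 : (0 < d)%N) (d'd : (d' %| d)%N)
    (a b : yh u d n) (x : yh u d n.+1) :
  yh_proj d_gt0 d'd (yh_incl a * x * yh_incl b) =
  yh_incl (yh_proj d_gt0 d'd a) * yh_proj d_gt0 d'd x * yh_incl (yh_proj d_gt0 d'd b).
Proof.
apply: etrans (rmorphM (@yh_proj K u d d' n.+1 d_gt0 d'd) _ _) _.
congr (_ * _); last exact: yh_proj_incl.
apply: etrans (rmorphM (@yh_proj K u d d' n.+1 d_gt0 d'd) _ _) _.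
by congr (_ * _); exact: yh_proj_incl.
Qed.

(** Both composites solve the recursion of the trace of level d', read on the
    tower of level d. *)
Lemma markov_trace_proj d d' (d_gt0 : (0 < d)%N) (d'd : (d' %| d)%N)
    (tr : forall n, {linear yh u d n -> trace_ring K d})
    (tr' : forall n, {linear yh u d' n -> trace_ring K d'}) :
  u != 0 -> markov_trace tr -> markov_trace tr' ->
  forall n (y : yh u d n), tr_proj K d d' (tr n y) = tr' n (yh_proj d_gt0 d'd y).
Proof.
move=> u_neq0 mt mt'; have d'_gt0 := dvdn_gt0 d_gt0 d'd.
pose f n : {linear yh u d n -> trace_ring K d'} := tr_proj K d d' \o tr n.
pose f' n : {linear yh u d n -> trace_ring K d'} := tr' n \o @yh_proj K u d d' n d_gt0 d'd.
have projM (s t : trace_ring K d) :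
  tr_proj K d d' (s * t) = tr_proj K d d' s * tr_proj K d d' t by exact: rmorphM.
have fE n y : f n y = tr_proj K d d' (tr n y) by [].
have f'E n y : f' n y = tr' n (yh_proj d_gt0 d'd y) by [].
apply: (@yh_trace_unique K u d u_neq0 d_gt0 _ (tr_z K d') (fun m => tr_x K d' m) f f').
  split=> [|n a m b|n a b]; rewrite ?fE.
  - by rewrite (mt_one mt) rmorph1.
  - by rewrite (markov_hX d_gt0 mt) projM tr_proj_x.
  - have := mt_g mt (ltn0Sn n) a b; rewrite last_genE => ->.
    by rewrite projM tr_proj_z.
split=> [|n a m b|n a b]; rewrite ?f'E.
- by rewrite rmorph1 (mt_one mt').
- rewrite yh_proj_sandwich yh_proj_hX.
  apply: etrans (markov_hX d'_gt0 mt' _ _ _) _.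
  by congr (_ * tr' n _); exact/esym/rmorphM.
- rewrite yh_proj_sandwich yh_proj_g.
  have := mt_g mt' (ltn0Sn n) (yh_proj d_gt0 d'd a) (yh_proj d_gt0 d'd b).
  rewrite last_genE => trg; apply: etrans trg _.
  by congr (_ * tr' n.+1 _); exact/esym/rmorphM.
Qed.

End Compat.

(** * The limit trace *)

Section Limit.
Variables (K : numFieldType) (p : nat) (p_prime : prime p) (u : K).

(** For m < 0 the power is an inverse in the limit algebra, defined there by
    choice; it is identified by cancelling it against a positive power. *)
Lemma lim_t_exprz n (i : 'I_n) (m : int) r :
  (lim_t p_prime u i ^ m) r = yh_h u (p ^ r.+1) i ^+ `|(m %% (p ^ r.+1)%N)%Z|%N.
Proof.
have d_gt0 := level_gt0 p_prime r; set d := (p ^ r.+1)%N in d_gt0 *.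
have dE (x : yh_lim p_prime u n) k : (x ^+ k) r = x r ^+ k.
  by elim: k => [//|k IH]; rewrite !exprS invlimME IH.
have hd := yh_hd u i d_gt0.
case: m => k; first by rewrite modz_nat absz_nat (expr_mod k hd); exact: dE.
set t := lim_t p_prime u i; set j := `|_|%N.
have hj : yh_h u d i ^+ k.+1 * yh_h u d i ^+ j = 1.
  have : (d %| k.+1 + j)%N.
    rewrite -[(_ %| _)%N]/(d %| (k.+1 + j)%:Z)%Z; apply/dvdz_mod0P.
    rewrite PoszD gez0_abs ?modz_ge0 -?lt0n // modzDmr NegzE addrN.
    exact: mod0z.
  by rewrite -exprD => /dvdnP[q ->]; rewrite mulnC exprM hd expr1n.
have tV : (t ^ Negz k) r * yh_h u d i ^+ k.+1 = 1.
  have tu : t ^+ k.+1 \is a GRing.unit by rewrite unitrX // lim_t_unit.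
  by have /(congr1 (fun x : yh_lim p_prime u n => x r)) := mulVr tu; rewrite invlimME dE.
by rewrite -[LHS]mulr1 -hj mulrA tV mul1r.
Qed.

Variable tau_ : forall r k : nat,
  {linear yh u (p ^ r.+1) k -> trace_ring K (p ^ r.+1)}.
Hypotheses (u_neq0 : u != 0) (tau_markov : forall r, markov_trace (tau_ r)).

Fact lim_trace_compat n (y : yh_lim p_prime u n) r s (sr : (s <= r)%N) :
  tr_proj K (p ^ r.+1) (p ^ s.+1) (tau_ r n (y r)) = tau_ s n (y s).
Proof.
rewrite (markov_trace_proj (level_gt0 p_prime r) (level_dvd p sr) u_neq0
  (tau_markov r) (tau_markov s)).
by congr (tau_ s n _); exact: (invlim_compat y sr).
Qed.

Definition lim_trace n (y : yh_lim p_prime u n) : trace_lim K p :=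
  InvLim (lim_trace_compat y).

Fact lim_trace_linear n : linear (@lim_trace n).
Proof. by move=> c x y; apply: invlimP => r; rewrite /= !linearP. Qed.

HB.instance Definition _ n := GRing.isLinear.Build K _ _ _ (@lim_trace n) (@lim_trace_linear n).

End Limit.

Theorem theorem5 (R : realType) (p : nat) (p_prime : prime p)
    (u : R[i]) (u_neq0 : u != 0) (n : nat) (n_gt0 : (0 < n)%N)
    (tau_ : forall r k : nat,
       {linear yh u (p ^ r.+1) k -> trace_ring R[i] (p ^ r.+1)})
    (tau_markov : forall r : nat, markov_trace (tau_ r)) :
  exists tau : {linear yh_lim p_prime u n.+1 -> trace_lim R[i] p},
    [/\ (forall (y : yh_lim p_prime u n.+1) (r : nat),
           tau y r = tau_ r n.+1 (y r)),
        (forall tau' : yh_lim p_prime u n.+1 -> trace_lim R[i] p,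
           (forall (y : yh_lim p_prime u n.+1) (r : nat),
              tau' y r = tau_ r n.+1 (y r)) -> tau' = tau)
      & forall a b : yh_lim p_prime u n,
        [/\ tau (lim_incl a * lim_incl b) = tau (lim_incl b * lim_incl a),
            tau 1 = 1,
            tau (lim_incl a *
                 lim_g p_prime u (last_gen n_gt0 : 'I_(n.+1).-1) *
                 lim_incl b) =
              lim_z R[i] p * tau (lim_incl a * lim_incl b)
          & forall m : int,
            tau (lim_incl a *
                 lim_t p_prime u (ord_max : 'I_n.+1) ^ m *
                 lim_incl b) =
              lim_x R[i] p_prime m * tau (lim_incl a * lim_incl b)]].
Proof.
pose tau : {linear yh_lim p_prime u n.+1 -> trace_lim R[i] p} :=
  @lim_trace _ p p_prime u tau_ u_neq0 tau_markov n.+1.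
have tauE y r : tau y r = tau_ r n.+1 (y r) by [].
exists tau; split=> [//|tau' tau'E|a b].
  by apply/funext => y; apply: invlimP => r; rewrite tau'E tauE.
split=> [|||m]; apply: invlimP => r; rewrite ?invlimME !tauE.
- exact: mt_mulC.
- exact: mt_one.
- rewrite !invlimME /= -rmorphM (mt_incl (tau_markov r)).
  exact: (mt_g (tau_markov r)).
rewrite !invlimME lim_t_exprz [lim_incl a r]/= [lim_incl b r]/= -rmorphM.
rewrite (mt_incl (tau_markov r)) (markov_hX (level_gt0 p_prime r) (tau_markov r)).
congr (_ * _); apply: tr_x_mod.
by rewrite gez0_abs ?modz_mod // modz_ge0 // -lt0n level_gt0.
Qed.
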